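(* Let $k\ge 1$ be an integer, let $\rho\ge 0$ be real, and let $g_\rho=g_{st}+\rho^2\,\eta\otimes\eta$ on $S^{4k+1}$, where $g_{st}$ is the standard round metric and $\eta$ is the standard contact one-form. If $\rho\neq 0$, then $$|\pi_1(\mathrm{Conf}(S^{4k+1},g_\rho))|=\infty .$$
   Context: For a Riemannian manifold $(M,g)$, $\mathrm{Conf}(M,g)=\{\psi\in\mathrm{Diff}(M):\psi^*g=fg\text{ for some } f\in C^\infty(M),\ f>0\}$, with the topology induced from $\mathrm{Diff}(M)$; $\pi_1$ is based at the identity. On the unit sphere $S^{4k+1}\subset\mathbb C^{2k+1}$, let $\pi:S^{4k+1}\to\mathbb{CP}^{2k}$ be the Hopf fibration. The vector field $\xi$ is the $g_{st}$-unit vector field tangent to the Hopf fibers (generating the circle action $z\mapsto e^{i\theta}z$); it is the Reeb vector field of the standard contact structure. The contact one-form $\eta$ is the dual of $\xi$, $\eta=g_{st}(\xi,\cdot)$, so that $\eta(\xi)=1$ and $d\eta(\xi,\cdot)=0$. *)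

(* Defs.v *)
From HB Require Import structures.
From mathcomp Require Import all_boot all_order all_algebra.
From mathcomp Require Import all_classical all_reals all_analysis.

Set Implicit Arguments.
Unset Strict Implicit.
Unset Printing Implicit Defensive.

Import Order.TTheory GRing.Theory Num.Theory.
Import numFieldNormedType.Exports.

Local Open Scope classical_set_scope.
Local Open Scope ring_scope.

(* C^n as the real vector space R^(n+n): the row [x y] stands for x + iy. *)
Definition Cn (R : realType) (n : nat) := 'rV[R]_(n + n).

(* multiplication by i: i(x + iy) = -y + ix *)
Definition mulI (R : realType) (n : nat) (z : Cn R n) : Cn R n :=
  row_mx (- rsubmx z) (lsubmx z).

(* the Euclidean inner product, i.e. the real part of the Hermitian one; the
   library norm `|z| on row vectors is the sup norm, hence [enorm] *)
Definition dot (R : realType) (n : nat) (u v : Cn R n) : R :=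
  \sum_i u 0 i * v 0 i.

Definition enorm (R : realType) (n : nat) (u : Cn R n) : R :=
  Num.sqrt (dot u u).

(* S^(2n-1) in C^n *)
Definition sphere (R : realType) (n : nat) := {x : Cn R n | dot x x == 1}.

Section Smooth.
Context {R : realType} {n : nat} {V : normedModType R}.
Implicit Types (F : Cn R n -> V) (f : sphere R n -> V).

(* D_(v1) (D_(v2) (... F)) for s = [:: v1; v2; ...] *)
Definition iter_derive (s : seq (Cn R n)) F : Cn R n -> V :=
  foldr (fun v G x => 'D_v G x) F s.

(* F is C^oo on the open set U *)
Definition smooth_on (U : set (Cn R n)) F :=
  forall (s : seq (Cn R n)) (x : Cn R n), U x ->
    differentiable (iter_derive s F) x.

(* The extension x |-> f (x / |x|), homogeneous of degree 0 (the value 0 at the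
   origin is irrelevant). Since x |-> x / |x| is a smooth retraction of
   C^n \ {0} onto the sphere, f is smooth on the submanifold S^(2n-1) iff its
   extension is smooth on C^n \ {0}. *)
Definition radial_ext f (x : Cn R n) : V :=
  oapp f 0 (insub ((enorm x)^-1 *: x)).

Definition smooth_sphere f := smooth_on [set x | x != 0] (radial_ext f).

(* Differential of f at x. For v tangent at x it is the derivative at t = 0 of f
   along t |-> (x + tv) / |x + tv|, a curve in the sphere with velocity v. *)
Definition sphere_diff f (x : sphere R n) (v : Cn R n) : V :=
  'D_v (radial_ext f) (\val x).

Definition sphere_iter_derive f (s : seq (Cn R n)) (x : sphere R n) : V :=
  iter_derive s (radial_ext f) (\val x).

End Smooth.

Definition tangent (R : realType) (n : nat) (x : sphere R n) : set (Cn R n) :=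
  [set v | dot (\val x) v = 0].

Section SphereMaps.
Context {R : realType} {n : nat}.

Definition sphere_jets (psi : sphere R n -> sphere R n) :
    prod_topology (fun _ : seq (Cn R n) => {uniform sphere R n -> Cn R n}) :=
  sphere_iter_derive (\val \o psi).

(* The self-maps of the sphere with the C^oo topology: uniform convergence on
   the sphere of the derivatives of every order. Only the subspace topology it
   induces on sets of smooth maps is meaningful. *)
Definition sphere_map := initial_topology sphere_jets.

HB.instance Definition _ := 
  Topological.copy sphere_map (initial_topology sphere_jets).

Definition smooth_map (psi : sphere R n -> sphere R n) :=
  smooth_sphere (\val \o psi : sphere R n -> Cn R n).

Definition Diff : set sphere_map :=
  [set psi | smooth_map psi /\ exists phi : sphere R n -> sphere R n,
    [/\ smooth_map phi, cancel psi phi & cancel phi psi]].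

(* a covariant 2-tensor field; only its values on tangent vectors matter *)
Definition tensor2 := sphere R n -> Cn R n -> Cn R n -> R.

Definition pullback (psi : sphere R n -> sphere R n) (g : tensor2) : tensor2 :=
  fun x v w => g (psi x) (sphere_diff (\val \o psi : _ -> Cn R n) x v)
                         (sphere_diff (\val \o psi : _ -> Cn R n) x w).

Definition Conf (g : tensor2) : set sphere_map :=
  [set psi | Diff psi /\ exists f : sphere R n -> R,
    [/\ smooth_sphere (f : sphere R n -> R^o),
        forall x, 0 < f x &
        forall x v w, tangent x v -> tangent x w ->
          pullback psi g x v w = f x * g x v w]].

Definition g_st : tensor2 := fun _ v w => dot v w.

(* the velocity d/dt (e^(it) x) at t = 0 of the Hopf circle action *)
Definition xi (x : sphere R n) : Cn R n := mulI (\val x).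

Definition eta (x : sphere R n) (v : Cn R n) : R := g_st x (xi x) v.

Definition g_rho (rho : R) : tensor2 :=
  fun x v w => g_st x v w + rho ^+ 2 * (eta x v * eta x w).

End SphereMaps.

Section FundamentalGroup.
Context {R : realType} {T : topologicalType}.

Definition I01 : set R := `[0, 1]%classic.

(* loops in the subspace A of T based at a; the values outside [0, 1] are
   irrelevant *)
Definition loops (A : set T) (a : T) : set (R -> T) :=
  [set gamma | [/\ {within I01, continuous gamma},
    forall t, I01 t -> A (gamma t), gamma 0 = a & gamma 1 = a]].

Definition loop_homotopic (A : set T) (a : T) (gamma delta : R -> T) :=
  exists H : R * R -> T,
    [/\ {within I01 `*` I01, continuous H},
        forall p, (I01 `*` I01) p -> A (H p),
        forall t, I01 t -> H (0, t) = gamma t /\ H (1, t) = delta t &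
        forall s, I01 s -> H (s, 0) = a /\ H (s, 1) = a].

(* the underlying set of the fundamental group of A based at a, each element
   being a class of homotopic loops *)
Definition pi1 (A : set T) (a : T) : set (set (R -> T)) :=
  [set [set delta | loops A a delta /\ loop_homotopic A a gamma delta]
     | gamma in loops A a].

End FundamentalGroup.

(* Main.v *)
(* Let F be the degree 0 homogeneous extension of a conformal map psi of g_rho and
   D_x the contact hyperplane, the orthogonal complement of x and ix. On quadruples
   of mutually orthogonal vectors the curvature tensor coincides with the Weyl tensor,
   hence is conformally invariant; for g_rho it is there
     2 w(a,b) w(c,d) + w(a,c) w(b,d) - w(a,d) w(b,c),   w(u,v) = <iu,v>,
   up to the factor rho^2. It vanishes if a is tangent to the Hopf fibre, and in
   complex dimension at least 3 that fibre is the only direction with this property.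
   So d psi preserves the Hopf direction and the contact hyperplanes, and
   differentiating psi^* eta (D) = 0 shows that d psi maps a unitary basis of D_p to
   a Hermitian-orthogonal one. Together with psi(p) the images form an invertible
   complex matrix, whose determinant is a continuous function from Conf to C \ {0}
   that sends the rotation e^(it) to e^(int). Its winding number distinguishes the
   powers of the Hopf loop. *)

Require Import Defs.
From HB Require Import structures.
From mathcomp Require Import all_boot all_order all_algebra.
From mathcomp Require Import all_classical all_reals all_analysis.
From mathcomp Require Import ring lra zify.

Set Implicit Arguments.
Unset Strict Implicit.
Unset Printing Implicit Defensive.

Import Order.TTheory GRing.Theory Num.Theory.
Import numFieldNormedType.Exports.

Local Open Scope classical_set_scope.
Local Open Scope ring_scope.

(** * The real inner product and multiplication by i *)

Section DotAlgebra.
Context {R : realType} {n : nat}.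
Implicit Types u v w : Cn R n.

(** Neither charts nor a connection appear: on C^n minus the origin, conformality becomes one
    identity between explicit functions of x, valid for all directions v and w, and curvature enters
    through its second derivatives. Combining these as in the coordinate formula for the Riemann
    tensor removes the third derivatives of F. The obstacle is what remains, the products of two
    second derivatives of F. The Koszul formula gives a second derivative only through its products
    with first derivatives; so one factor is rewritten as some D_k F, which is possible because d
    psi is onto the tangent space. Since the resulting identity carries the factor rho^2, it says
    nothing about the round metric, and rho <> 0 is indispensable to this route.

    Homotopy invariance of the winding number is proved by discretisation: oriented angles between
    values at neighbouring grid points are added up, and the sums for consecutive rows agree by
    telescoping. The determinant winds n a times along the a-th power of the Hopf loop, and n > 0
    can be cancelled. *)

Lemma dotC u v : dot u v = dot v u.
Proof. by apply: eq_bigr => i _; rewrite mulrC. Qed.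

Lemma dotDl u v w : dot (u + v) w = dot u w + dot v w.
Proof. by rewrite -big_split; apply: eq_bigr => i _; rewrite mxE mulrDl. Qed.

Lemma dotZl (a : R) u w : dot (a *: u) w = a * dot u w.
Proof. by rewrite [RHS]big_distrr /=; apply: eq_bigr => i _; rewrite mxE mulrA. Qed.

Lemma dotDr u v w : dot w (u + v) = dot w u + dot w v.
Proof. by rewrite dotC dotDl !(dotC w). Qed.

Lemma dotZr (a : R) u w : dot w (a *: u) = a * dot w u.
Proof. by rewrite dotC dotZl dotC. Qed.

Lemma dotNl u w : dot (- u) w = - dot u w.
Proof. by rewrite -scaleN1r dotZl mulN1r. Qed.

Lemma dotNr u w : dot w (- u) = - dot w u.
Proof. by rewrite dotC dotNl dotC. Qed.

Lemma dot0l w : dot 0 w = 0.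
Proof. by rewrite -(scale0r w) dotZl mul0r. Qed.

Lemma dot0r w : dot w 0 = 0.
Proof. by rewrite dotC dot0l. Qed.

Lemma dot_ge0 u : 0 <= dot u u.
Proof. by apply: sumr_ge0 => i _; rewrite -expr2 sqr_ge0. Qed.

Lemma dot_eq0 u : (dot u u == 0) = (u == 0).
Proof.
apply/idP/eqP => [|->]; last by rewrite dot0l.
rewrite psumr_eq0 => [/allP h|i _]; last by rewrite -expr2 sqr_ge0.
apply/rowP => i; rewrite mxE; apply/eqP.
by have := h i (mem_index_enum _); rewrite mulf_eq0 orbb.
Qed.

Lemma dot_gt0 u : u != 0 -> 0 < dot u u.
Proof. by move=> u0; rewrite lt_neqAle dot_ge0 eq_sym dot_eq0 u0. Qed.

Lemma dot_mx u v : dot u v = (u *m v^T) 0 0.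
Proof. by rewrite mxE; apply: eq_bigr => i _; rewrite mxE. Qed.

Lemma mulI_is_linear : linear (@mulI R n).
Proof.
move=> a u v; rewrite /mulI scale_row_mx add_row_mx; congr row_mx.
  by apply/rowP => i; rewrite !mxE opprD mulrN.
by apply/rowP => i; rewrite !mxE.
Qed.
HB.instance Definition _ := @GRing.isLinear.Build R (Cn R n) (Cn R n) _
  (@mulI R n) mulI_is_linear.

Lemma mulID u v : mulI (u + v) = mulI u + mulI v.
Proof. exact: linearD. Qed.

Lemma mulIZ (a : R) u : mulI (a *: u) = a *: mulI u.
Proof. exact: linearZ. Qed.

Lemma mulI_mulI u : mulI (mulI u) = - u.
Proof.
rewrite /mulI row_mxKr row_mxKl -[in RHS](hsubmxK u) opp_row_mx.
by [].
Qed.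

Lemma dot_row (a b c d : 'rV[R]_n) :
  dot (row_mx a b : Cn R n) (row_mx c d) = (a *m c^T + b *m d^T) 0 0.
Proof. by rewrite dot_mx tr_row_mx mul_row_col. Qed.

Lemma dot_mulI u v : dot (mulI u) v = - dot u (mulI v).
Proof.
rewrite -(hsubmxK u) -(hsubmxK v) /mulI !row_mxKl !row_mxKr !dot_row.
by rewrite mulNmx !mxE opprD -!sumrN addrC; congr (_ + _);
  apply: eq_bigr => i _; rewrite !mxE ?mulrN ?opprK.
Qed.

Lemma dot_mulIC u v : dot (mulI u) v = - dot (mulI v) u.
Proof. by rewrite dot_mulI dotC. Qed.

Lemma dot_mulIr u v : dot u (mulI v) = - dot (mulI u) v.
Proof. by rewrite dot_mulI opprK. Qed.

Lemma dot_mulII u v : dot (mulI u) (mulI v) = dot u v.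
Proof. by rewrite dot_mulI mulI_mulI dotNr opprK. Qed.

Lemma dot_mulI_self u : dot (mulI u) u = 0.
Proof. by have := dot_mulI u u; rewrite (dotC u) => h; lra. Qed.

Lemma mulI_eq0 u : (mulI u == 0) = (u == 0).
Proof. by rewrite -!dot_eq0 dot_mulII. Qed.

End DotAlgebra.

(** * Directional derivatives *)

Section IsDerive.
Context {R : realType} {V : normedModType R}.

Lemma is_derive_coordP {n : nat} (f : V -> 'rV[R]_n) x v (df : 'rV[R]_n) :
  is_derive x v f df <->
  forall i, is_derive x v (fun y => f y 0 i) (df 0 i).
Proof.
split=> [[fx <-] i|h].
  have fi : derivable (fun y => f y 0 i) x v by exact: (derivable_mxP f x v).1.
  by split=> //; rewrite derive_mx// mxE.
have fx : derivable f x v.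
  by apply/derivable_mxP => i j; rewrite (ord1 i); case: (h j).
split=> //; rewrite derive_mx//; apply/rowP => i; rewrite mxE.
by case: (h i).
Qed.

Lemma is_derive_fun (f g : V -> R) x v a b :
  is_derive x v f a -> (forall y, f y = g y) -> a = b -> is_derive x v g b.
Proof. by move=> h /funext <- <-. Qed.

Lemma is_derive_add (f g : V -> R) x v df dg :
  is_derive x v f df -> is_derive x v g dg ->
  is_derive x v (fun y => f y + g y) (df + dg).
Proof. exact: is_deriveD. Qed.

Lemma is_derive_opp (f : V -> R) x v df :
  is_derive x v f df -> is_derive x v (fun y => - f y) (- df).
Proof. exact: is_deriveN. Qed.

Lemma is_derive_mul (f g : V -> R) x v df dg :
  is_derive x v f df -> is_derive x v g dg ->
  is_derive x v (fun y => f y * g y) (f x * dg + g x * df).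
Proof. exact: is_deriveM. Qed.

Lemma is_derive_big (I : Type) (s : seq I) (f : I -> V -> R) x v (df : I -> R) :
  (forall i, is_derive x v (f i) (df i)) ->
  is_derive x v (fun y => \sum_(i <- s) f i y) (\sum_(i <- s) df i).
Proof.
move=> h; elim: s => [|i s IH].
  apply: (is_derive_fun (f := cst 0) (a := 0)); rewrite ?big_nil//.
  by move=> y; rewrite big_nil.
rewrite big_cons; apply: is_derive_fun (is_derive_add (h i) IH) _ _ => //= y.
by rewrite big_cons.
Qed.

Lemma is_derive_dot {n : nat} (f g : V -> Cn R n) x v df dg :
  is_derive x v f df -> is_derive x v g dg ->
  is_derive x v (fun y => dot (f y) (g y)) (dot df (g x) + dot (f x) dg).
Proof.
move=> /is_derive_coordP hf /is_derive_coordP hg.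
have := is_derive_big (index_enum 'I_(n + n))
  (fun i => is_derive_mul (hf i) (hg i)).
move=> /is_derive_fun; apply=> //.
rewrite /= big_split /= addrC; congr (_ + _).
by apply: eq_bigr => i _; rewrite mulrC.
Qed.

Lemma is_derive_mulI {n : nat} (f : V -> Cn R n) x v df :
  is_derive x v f df -> is_derive x v (fun y => mulI (f y)) (mulI df).
Proof.
move=> /is_derive_coordP hf; apply/is_derive_coordP => i.
rewrite /mulI; case: (split_ordP i) => j -> /=.
  apply: is_derive_fun (is_derive_opp (hf (rshift n j))) _ _ => [y|];
    by rewrite row_mxEl !mxE.
apply: is_derive_fun (hf (lshift n j)) _ _ => [y|];
  by rewrite row_mxEr !mxE.
Qed.

Lemma is_derive_unique_near (W : normedModType R) (f g : V -> W) x v a b :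
  is_derive x v f a -> is_derive x v g b -> (\near x, f x = g x) -> a = b.
Proof.
by move=> [_ <-] [_ <-]; exact: near_eq_derive.
Qed.

End IsDerive.

(** * Symmetry of second derivatives *)

Section Schwarz.
Context {R : realType} {V : normedModType R}.

Lemma is_derive_line (W : normedModType R) (f : V -> W) y v (s : R) d :
  is_derive (y + s *: v) v f d -> is_derive s 1 (fun t => f (y + t *: v)) d.
Proof.
move=> [fv <-].
have E : (fun h => h^-1 *: (f (y + (h *: (1 : R^o) + s) *: v) - f (y + s *: v)))
  = (fun h => h^-1 *: (f (h *: v + (y + s *: v)) - f (y + s *: v))).
  apply/funext => h; congr (_ *: (f _ - _)).
  by rewrite [h *: 1]mulr1 scalerDl addrCA.
by split; rewrite /derivable /derive /= E.
Qed.

(** Two mean value theorems: one for the increment of G along w as a function of s, whose derivative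
    is an increment of D_v G, and one for D_v G along w. *)
Lemma mixed_MVT (G : V -> R) x v w (h : R) : 0 < h ->
  (forall s t, 0 <= s <= h -> 0 <= t <= h ->
    derivable G (x + s *: v + t *: w) v /\
    derivable ('D_v G) (x + s *: v + t *: w) w) ->
  exists s t, [/\ 0 <= s <= h, 0 <= t <= h &
    G (x + h *: v + h *: w) - G (x + h *: v) - G (x + h *: w) + G x =
    h ^+ 2 * 'D_w ('D_v G) (x + s *: v + t *: w)].
Proof.
move=> h0 H.
have dG s t : 0 <= s <= h -> 0 <= t <= h ->
    is_derive s 1 (fun s => G (x + t *: w + s *: v))
      ('D_v G (x + t *: w + s *: v)).
  move=> hs ht; apply: is_derive_line.
  have [dv _] := H s t hs ht.
  by apply: derivableP; rewrite addrAC; exact: dv.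
have hh : 0 <= h <= h by rewrite lexx ltW.
have h00 : (0 : R) <= 0 <= h by rewrite lexx ltW.
pose phi s := G (x + h *: w + s *: v) - G (x + 0 *: w + s *: v).
have dphi s : 0 <= s <= h -> is_derive s 1 phi
    ('D_v G (x + h *: w + s *: v) - 'D_v G (x + 0 *: w + s *: v)).
  by move=> hs; apply: is_deriveB (dG s h hs hh) (dG s 0 hs h00).
have cphi : {within `[0, h], continuous phi}.
  apply: derivable_within_continuous => s hs.
  by case: (dphi s hs).
have [s] := MVT h0 (fun s hs => dphi s (subset_itv_oo_cc hs)) cphi.
move=> /subset_itv_oo_cc hs; rewrite subr0 => Es.
have hs' : 0 <= s <= h by exact: hs.
pose chi t := 'D_v G (x + s *: v + t *: w).
have dchi t : 0 <= t <= h -> is_derive t 1 chi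
    ('D_w ('D_v G) (x + s *: v + t *: w)).
  move=> ht; apply: (is_derive_line (f := 'D_v G)).
  by have [_ /derivableP] := H s t hs' ht.
have cchi : {within `[0, h], continuous chi}.
  apply: derivable_within_continuous => t ht.
  by case: (dchi t ht).
have [t] := MVT h0 (fun t ht => dchi t (subset_itv_oo_cc ht)) cchi.
move=> /subset_itv_oo_cc ht; rewrite subr0 => Et.
exists s, t; split => //.
rewrite expr2 -mulrA [h * 'D_w _ _]mulrC -Et.
rewrite mulrC /chi scale0r addr0.
transitivity (phi h - phi 0); last first.
  rewrite Es; congr (_ * h); congr ('D_v G _ - 'D_v G _).
    by rewrite addrAC.
  by rewrite scale0r addr0.
rewrite /phi !scale0r !addr0 (addrAC x); ring.
Qed.

(** The double difference in [mixed_MVT] is symmetric in v and w. So in every small parallelogram at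
    x the two mixed derivatives take a common value, each at its own point, and continuity at x
    forces equality there. *)
Lemma schwarz (G : V -> R) x v w :
  (\forall y \near x, [/\ derivable G y v, derivable G y w,
     derivable ('D_v G) y w & derivable ('D_w G) y v]) ->
  {for x, continuous ('D_w ('D_v G))} ->
  {for x, continuous ('D_v ('D_w G))} ->
  'D_w ('D_v G) x = 'D_v ('D_w G) x.
Proof.
move=> HG /cvgrPdist_lt c1 /cvgrPdist_lt c2.
apply/eqP/negPn/negP => neq.
pose e := `|'D_w ('D_v G) x - 'D_v ('D_w G) x| / 2.
have e0 : 0 < e by rewrite divr_gt0// normr_gt0 subr_eq0.
have [d /= d0 Hd] : \forall r \near (0 : R)^'+, forall s t,
    0 <= s <= r -> 0 <= t <= r ->
    [/\ derivable G (x + s *: v + t *: w) v,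
        derivable G (x + s *: v + t *: w) w,
        derivable ('D_v G) (x + s *: v + t *: w) w &
        derivable ('D_w G) (x + s *: v + t *: w) v] /\
    `|'D_w ('D_v G) x - 'D_w ('D_v G) (x + s *: v + t *: w)| < e /\
    `|'D_v ('D_w G) x - 'D_v ('D_w G) (x + s *: v + t *: w)| < e.
  have /nbhs_ballP[r /= r0 Hr] : \forall y \near x,
      [/\ derivable G y v, derivable G y w,
        derivable ('D_v G) y w & derivable ('D_w G) y v] /\
      `|'D_w ('D_v G) x - 'D_w ('D_v G) y| < e /\
      `|'D_v ('D_w G) x - 'D_v ('D_w G) y| < e.
    have k1 : \forall t \near x, `|'D_w ('D_v G) x - 'D_w ('D_v G) t| < e.
      exact: c1.
    have k2 : \forall t \near x, `|'D_v ('D_w G) x - 'D_v ('D_w G) t| < e.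
      exact: c2.
    exact: (filterI HG (filterI k1 k2)).
  (* [d * m] bounds the norm of [s *: v + t *: w] for s, t at most d; the added 1 keeps m positive
     when v and w vanish. *)
  pose m := `|v| + `|w| + 1.
  have m0 : 0 < m by rewrite ltr_wpDl// addr_ge0.
  near=> d => s t /andP[s0 sd] /andP[t0 td].
  have rd : d * m < r.
    rewrite -ltr_pdivlMr//; near: d.
    by apply: nbhs_right_lt; rewrite divr_gt0.
  apply: Hr; rewrite -ball_normE /=; rewrite -addrA opprD addrA subrr sub0r normrN.
  apply: le_lt_trans rd; apply: (le_trans (ler_normD _ _)).
  rewrite !normrZ !ger0_norm// /m !mulrDr mulr1.
  rewrite (@le_trans _ _ (d * `|v| + d * `|w|))//.
    by rewrite lerD// ler_wpM2r.
  by rewrite lerDl (le_trans s0).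
pose h := d / 2.
have h0 : 0 < h by rewrite divr_gt0.
have {}Hd := Hd h _ h0.
have /Hd{}Hd : `|0 - h| < d.
  by rewrite sub0r normrN gtr0_norm// /h ltr_pdivrMr// mulr2n mulrDr mulr1 ltrDl.
have [s [t [hs ht E1]]] : exists s t, [/\ 0 <= s <= h, 0 <= t <= h &
    G (x + h *: v + h *: w) - G (x + h *: v) - G (x + h *: w) + G x =
    h ^+ 2 * 'D_w ('D_v G) (x + s *: v + t *: w)].
  apply: (mixed_MVT h0) => s t hs ht.
  have [[dv _ dvw _] _] := Hd s t hs ht; exact: (conj dv dvw).
have [t' [s' [ht' hs' E2]]] : exists s t, [/\ 0 <= s <= h, 0 <= t <= h &
    G (x + h *: w + h *: v) - G (x + h *: w) - G (x + h *: v) + G x =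
    h ^+ 2 * 'D_v ('D_w G) (x + s *: w + t *: v)].
  apply: (mixed_MVT h0) => s1 t1 hs1 ht1; rewrite addrAC.
  have [[_ dw _ dwv] _] := Hd t1 s1 ht1 hs1; exact: (conj dw dwv).
have EE : 'D_w ('D_v G) (x + s *: v + t *: w) =
          'D_v ('D_w G) (x + s' *: v + t' *: w).
  have hn : h ^+ 2 != 0 by rewrite expf_neq0// gt_eqF.
  rewrite (addrAC x (s' *: v)); apply: (mulfI hn).
  apply: (etrans (esym E1)); apply: (etrans _ E2).
  by rewrite (addrAC x (h *: w)); ring.
have [_ [l1 _]] := Hd s t hs ht.
have [_ [_ l2]] := Hd s' t' hs' ht'.
have : `|'D_w ('D_v G) x - 'D_v ('D_w G) x| < e + e.
  rewrite -(subrKA ('D_w ('D_v G) (x + s *: v + t *: w))).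
  apply: (le_lt_trans (ler_normD _ _)); apply: ltrD; first exact: l1.
  by rewrite EE distrC; exact: l2.
by rewrite /e -splitr ltxx.
Unshelve. all: by end_near. Qed.

End Schwarz.

(** * Functions smooth off the origin *)

Section Punctured.
Context {R : realType} {n : nat}.
Implicit Types x y v w : Cn R n.

Definition punctured : set (Cn R n) := [set x | x != 0].

Lemma near_punctured x : x != 0 -> \forall y \near x, y != 0.
Proof.
move=> x0; have : open_nbhs x (~` [set (0 : Cn R n)]).
  split; last exact/eqP.
  exact/closed_openC/accessible_closed_set1/hausdorff_accessible/norm_hausdorff.
by move=> /open_nbhs_nbhs; apply: filterS => y /eqP.
Qed.

Section Val.
Context {V : normedModType R}.
Implicit Types F : Cn R n -> V.

Lemma is_derive_punctured F G x v d : x != 0 ->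
  (forall y, y != 0 -> F y = G y) -> is_derive x v F d -> is_derive x v G d.
Proof.
move=> x0 FG; apply: near_eq_is_derive.
by apply: filterS (near_punctured x0) => y; exact: FG.
Qed.

Lemma is_derive_unique F G x v a b : x != 0 ->
  is_derive x v F a -> is_derive x v G b -> (forall y, y != 0 -> F y = G y) ->
  a = b.
Proof.
move=> x0 hF hG FG; apply: (is_derive_unique_near hF hG).
by apply: filterS (near_punctured x0) => y; exact: FG.
Qed.

Lemma smooth_on_iter F s : smooth_on punctured F ->
  smooth_on punctured (iter_derive s F).
Proof.
by move=> sF t x x0; have := sF (t ++ s) x x0; rewrite /iter_derive foldr_cat.
Qed.

Lemma smooth_on_derive F v : smooth_on punctured F ->
  smooth_on punctured ('D_v F).
Proof. exact: (@smooth_on_iter F [:: v]). Qed.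

Lemma smooth_on_differentiable F x : smooth_on punctured F -> x != 0 ->
  differentiable F x.
Proof. by move=> sF x0; exact: (sF [::] x x0). Qed.

Lemma smooth_on_is_derive F x v : smooth_on punctured F -> x != 0 ->
  is_derive x v F ('D_v F x).
Proof.
move=> sF x0; apply: derivableP; apply: diff_derivable.
exact: smooth_on_differentiable.
Qed.

Lemma deriveDv F x u v : differentiable F x ->
  'D_(u + v) F x = 'D_u F x + 'D_v F x.
Proof. by move=> dF; rewrite !deriveE// linearD. Qed.

Lemma deriveZv F x (a : R) v : differentiable F x ->
  'D_(a *: v) F x = a *: 'D_v F x.
Proof. by move=> dF; rewrite !deriveE// linearZ. Qed.

End Val.

(** [schwarz] is scalar, hence the passage to coordinates. Derivatives of a coordinate of F are
    identified with coordinates of derivatives of F off the origin, so each identity is transported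
    through a neighbourhood of x that avoids 0. *)
Lemma schwarz_Cn (F : Cn R n -> Cn R n) x v w : smooth_on punctured F ->
  x != 0 -> 'D_w ('D_v F) x = 'D_v ('D_w F) x.
Proof.
move=> sF x0; apply/rowP => i; pose G (y : Cn R n) : R := F y 0 i.
have dG u y : y != 0 -> is_derive y u G ('D_u F y 0 i).
  by move=> y0; apply: (is_derive_coordP _ _ _ _).1; exact: smooth_on_is_derive.
have dGE u y : y != 0 -> 'D_u G y = 'D_u F y 0 i.
  by move=> y0; case: (dG u y y0).
have ddG u u' y : y != 0 -> is_derive y u' ('D_u G) ('D_u' ('D_u F) y 0 i).
  move=> y0; apply: (@is_derive_punctured R (fun z => 'D_u F z 0 i)) => //.
    by move=> z z0; rewrite dGE.
  apply: (is_derive_coordP _ _ _ _).1.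
  by apply: smooth_on_is_derive => //; exact: smooth_on_derive.
have ddGE u u' y : y != 0 -> 'D_u' ('D_u G) y = 'D_u' ('D_u F) y 0 i.
  by move=> y0; case: (ddG u u' y y0).
have cG u u' : {for x, continuous ('D_u' ('D_u G))}.
  have c : {for x, continuous (fun z => 'D_u' ('D_u F) z 0 i)}.
    apply: differentiable_continuous.
    apply: (@differentiable_comp R _ _ _ ('D_u' ('D_u F))
      (fun M : 'rV[R]_(n + n) => M 0 i)).
      by apply: smooth_on_differentiable => //; exact: (@smooth_on_iter _ F [:: u'; u]).
    exact: differentiable_coord.
  suff : 'D_u' ('D_u G) y @[y --> x] --> 'D_u' ('D_u G) x by [].
  have e : \forall y \near x, 'D_u' ('D_u F) y 0 i = 'D_u' ('D_u G) y.
    by apply: filterS (near_punctured x0) => y y0; rewrite ddGE.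
  by rewrite ddGE//; exact: cvg_trans (near_eq_cvg e) c.
apply: (etrans (esym (ddGE v w x x0))).
apply: (etrans _ (ddGE w v x x0)); apply: schwarz.
- apply: filterS (near_punctured x0) => y y0.
  by split; [case: (dG v y y0)|case: (dG w y y0)|case: (ddG v w y y0)|
    case: (ddG w v y y0)].
- exact: cG.
- exact: cG.
Qed.

End Punctured.

(** * The curvature obstruction *)

(** Four real linear conditions in real dimension 2n leave a nonzero solution. This is the source of
    the bound n > 2: a complex direction Hermitian-orthogonal to both q and e must exist. *)
Lemma exists_dot_orthogonal {R : realType} {n : nat} (q e : Cn R n) :
  (2 < n)%N -> exists2 u : Cn R n, u != 0 &
  [/\ dot q u = 0, dot (mulI q) u = 0, dot e u = 0 & dot (mulI e) u = 0].
Proof.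
move=> n2; pose M : 'M[R]_(4, n + n) :=
  \matrix_i nth 0 [:: q; mulI q; e; mulI e] i.
have /rowV0Pn[u] : kermx M^T != 0.
  rewrite -mxrank_eq0 mxrank_ker subn_eq0 -ltnNge.
  by rewrite (leq_ltn_trans (rank_leq_col _))//; lia.
move=> /sub_kermxP uM u0; exists u => //.
have H (i : 'I_4) : dot (nth 0 [:: q; mulI q; e; mulI e] i) u = 0.
  have := congr1 (fun A : 'rV_4 => A 0 i) uM; rewrite !mxE => <-.
  by apply: eq_bigr => j _; rewrite !mxE mulrC.
by split; [exact: (H (@Ordinal 4 0 _))|exact: (H (@Ordinal 4 1 _))|
  exact: (H (@Ordinal 4 2 _))|exact: (H (@Ordinal 4 3 _))].
Qed.

(** * Derivatives of the conformality relation *)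

Section Koszul.
Context {R : realType} {n : nat} (rho : R) (F : Cn R n -> Cn R n).
Context (fh : Cn R n -> R) (f1 : Cn R n -> Cn R n -> R)
  (f2 : Cn R n -> Cn R n -> Cn R n -> R).
Implicit Types x y z v w : Cn R n.

(* |x|^4 times the pullback of g_rho under the retraction x |-> x / |x|, which is
   polynomial in x; [hform1] and [hform2] are its first and second derivatives
   in the directions z, and y and z. *)
Definition hform x v w : R :=
  dot x x * dot v w - dot x v * dot x w
  + rho ^+ 2 * (dot (mulI x) v * dot (mulI x) w).

Definition hform1 x z v w : R :=
  2 * dot x z * dot v w - dot z v * dot x w - dot x v * dot z w
  + rho ^+ 2 * (dot (mulI z) v * dot (mulI x) w
                + dot (mulI x) v * dot (mulI z) w).

Definition hform2 y z v w : R :=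
  2 * dot y z * dot v w - dot z v * dot y w - dot y v * dot z w
  + rho ^+ 2 * (dot (mulI z) v * dot (mulI y) w
                + dot (mulI y) v * dot (mulI z) w).

(* E v, E2 z v and E3 y z v stand for D_v F, D_z D_v F and D_y D_z D_v F, and f1,
   f2 for the derivatives of the conformal factor fh. *)
Context (E : Cn R n -> Cn R n -> Cn R n) (E2 : Cn R n -> Cn R n -> Cn R n -> Cn R n)
  (E3 : Cn R n -> Cn R n -> Cn R n -> Cn R n -> Cn R n).

Hypothesis dE : forall x v, x != 0 -> is_derive x v F (E v x).
Hypothesis dE2 : forall x z v, x != 0 -> is_derive x z (E v) (E2 z v x).
Hypothesis dE3 : forall x y z v, x != 0 -> is_derive x y (E2 z v) (E3 y z v x).
Hypothesis E2C : forall x z v, x != 0 -> E2 z v x = E2 v z x.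
Hypothesis E3C : forall x y z v, x != 0 -> E3 y z v x = E3 z y v x.
Hypothesis F1 : forall x, x != 0 -> dot (F x) (F x) = 1.
Hypothesis df1 : forall x z, x != 0 -> is_derive x z fh (f1 z x).
Hypothesis df2 : forall x y z, x != 0 -> is_derive x y (f1 z) (f2 y z x).

(* the pullback F^* eta of the contact form, and its derivatives *)
Local Notation th v y := (dot (mulI (F y)) (E v y)).
Local Notation th1 z v y :=
  (dot (mulI (E z y)) (E v y) + dot (mulI (F y)) (E2 z v y)).
Local Notation th2 y z v x :=
  (dot (mulI (E2 y z x)) (E v x) + dot (mulI (E z x)) (E2 y v x)
   + (dot (mulI (E y x)) (E2 z v x) + dot (mulI (F x)) (E3 y z v x))).

(** In the application [fh] is the conformal factor divided by |x|^4, which compensates the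
    normalisation of [hform]. Radial directions lie in the kernel of both forms, so v and w need not
    be tangent. *)
Hypothesis conf : forall x v w, x != 0 ->
  dot (E v x) (E w x) + rho ^+ 2 * (th v x * th w x) = fh x * hform x v w.

Ltac der := repeat first
  [ eassumption
  | apply: dE; assumption | apply: dE2; assumption | apply: dE3; assumption
  | apply: df1; assumption | apply: df2; assumption
  | exact: is_derive_id | exact: is_derive_cst
  | eapply is_derive_add | eapply is_derive_opp | eapply is_derive_mul
  | eapply is_derive_dot | eapply is_derive_mulI ].

Lemma dot_F_E x v : x != 0 -> dot (F x) (E v x) = 0.
Proof.
move=> x0.
have hl : is_derive x v (fun y => dot (F y) (F y))
    (dot (E v x) (F x) + dot (F x) (E v x)) by der.
have hr : is_derive x v (fun _ : Cn R n => 1 : R) 0 by der.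
by have := is_derive_unique x0 hl hr F1; rewrite dotC => h; lra.
Qed.

Lemma dot_F_E2 x z v : x != 0 -> dot (F x) (E2 z v x) = - dot (E z x) (E v x).
Proof.
move=> x0.
have hl : is_derive x z (fun y => dot (F y) (E v y))
    (dot (E z x) (E v x) + dot (F x) (E2 z v x)).
  by eapply is_derive_eq; [der|].
have hr : is_derive x z (fun _ : Cn R n => 0 : R) 0 by der.
by have /addr0_eq <- := is_derive_unique x0 hl hr (fun y => @dot_F_E y v).
Qed.

Lemma is_derive_hform x z v w :
  is_derive x z (fun y => hform y v w) (hform1 x z v w).
Proof.
rewrite /hform; eapply is_derive_eq; [der|].
rewrite /= /hform1 !dot0r (dotC z x); ring.
Qed.

Lemma is_derive_hform1 x y z v w :
  is_derive x y (fun x => hform1 x z v w) (hform2 y z v w).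
Proof.
rewrite /hform1; eapply is_derive_eq; [der|].
rewrite /= /hform2 ?dot0l !dot0r; ring.
Qed.

Lemma conf1 x z v w : x != 0 ->
  dot (E2 z v x) (E w x) + dot (E v x) (E2 z w x)
  + rho ^+ 2 * (th1 z v x * th w x + th v x * th1 z w x)
  = f1 z x * hform x v w + fh x * hform1 x z v w.
Proof.
move=> x0.
have hl : is_derive x z
    (fun y => dot (E v y) (E w y) + rho ^+ 2 * (th v y * th w y))
    (dot (E2 z v x) (E w x) + dot (E v x) (E2 z w x)
     + rho ^+ 2 * (th1 z v x * th w x + th v x * th1 z w x)).
  eapply is_derive_eq; [der|].
  by rewrite /=; ring.
have hr : is_derive x z (fun y => fh y * hform y v w)
    (f1 z x * hform x v w + fh x * hform1 x z v w).
  apply: is_derive_eq (is_derive_mul (df1 z x0) (is_derive_hform x z v w)) _.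
  by ring.
exact: is_derive_unique x0 hl hr (fun y => @conf y v w).
Qed.

Lemma conf2 x y z v w : x != 0 ->
  dot (E3 y z v x) (E w x) + dot (E2 z v x) (E2 y w x)
  + dot (E2 y v x) (E2 z w x) + dot (E v x) (E3 y z w x)
  + rho ^+ 2 * (th2 y z v x * th w x + th1 z v x * th1 y w x
                + th1 y v x * th1 z w x + th v x * th2 y z w x)
  = f2 y z x * hform x v w + f1 z x * hform1 x y v w
    + f1 y x * hform1 x z v w + fh x * hform2 y z v w.
Proof.
move=> x0.
have hl : is_derive x y
    (fun x => dot (E2 z v x) (E w x) + dot (E v x) (E2 z w x)
       + rho ^+ 2 * (th1 z v x * th w x + th v x * th1 z w x))
    (dot (E3 y z v x) (E w x) + dot (E2 z v x) (E2 y w x)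
     + dot (E2 y v x) (E2 z w x) + dot (E v x) (E3 y z w x)
     + rho ^+ 2 * (th2 y z v x * th w x + th1 z v x * th1 y w x
                   + th1 y v x * th1 z w x + th v x * th2 y z w x)).
  eapply is_derive_eq; [der|].
  by rewrite /=; ring.
have hr : is_derive x y
    (fun x => f1 z x * hform x v w + fh x * hform1 x z v w)
    (f2 y z x * hform x v w + f1 z x * hform1 x y v w
     + f1 y x * hform1 x z v w + fh x * hform2 y z v w).
  apply: is_derive_eq (is_derive_add
    (is_derive_mul (df2 y z x0) (is_derive_hform x y v w))
    (is_derive_mul (df1 y x0) (is_derive_hform1 x y z v w))) _.
  by ring.
exact: is_derive_unique x0 hl hr (fun y => @conf1 y z v w).
Qed.

(** [E2C] holds on the whole punctured space and may therefore be differentiated; with [E3C] it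
    makes [E3] symmetric in its three directions. *)
Lemma E3Cr x y z v : x != 0 -> E3 y z v x = E3 y v z x.
Proof.
move=> x0; apply: is_derive_unique x0 (dE3 y z v x0) (dE3 y v z x0) _.
by move=> t t0; exact: E2C.
Qed.

(* The Koszul formula: the left-hand side is 2 g_rho(K, D_w F) for the covariant
   second derivative K = E2 z v + rho^2 (th v . i E z + th z . i E v) of F. *)
Lemma koszul x z v w : x != 0 ->
  2 * (dot (E2 z v x) (E w x)
       + rho ^+ 2 * (dot (mulI (F x)) (E2 z v x) * th w x
                     + th v x * dot (mulI (E z x)) (E w x)
                     + th z x * dot (mulI (E v x)) (E w x)))
  = f1 z x * hform x v w + f1 v x * hform x z w - f1 w x * hform x z v
    + fh x * (hform1 x z v w + hform1 x v z w - hform1 x w z v).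
Proof.
(* The Levi-Civita combination [conf1 z v w] + [conf1 v z w] - [conf1 w z v], in which the second
   derivatives [E2 z w] and [E2 v w] cancel. *)
move=> x0; have := conf1 z v w x0; have := conf1 v z w x0; have := conf1 w z v x0.
rewrite (E2C v z x0) (E2C w z x0) (E2C w v x0).
rewrite (dot_mulIC (E w x) (E z x)) (dot_mulIC (E w x) (E v x)).
rewrite (dot_mulIC (E v x) (E z x)).
rewrite (dotC (E v x) (E2 z w x)) (dotC (E z x) (E2 v w x)).
by move=> h1 h2 h3; lra.
Qed.

(** * The Weyl identity at a point and its consequences *)

Section Pointwise.
Context (p : Cn R n).
Hypothesis p1 : dot p p = 1.
Hypothesis fh0 : fh p != 0.
Hypothesis surj : forall u, dot (F p) u = 0 ->
  exists2 k, dot p k = 0 & E k p = u.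

Let p0 : p != 0.
Proof.
by apply/eqP => p0; move: p1; rewrite p0 dot0l => /eqP; rewrite eq_sym oner_eq0.
Qed.

Definition contact x v := dot x v = 0 /\ dot (mulI x) v = 0.

Lemma contact_mulI x v : contact x v -> contact x (mulI v).
Proof.
by case=> h1 h2; split; rewrite ?dot_mulII// dot_mulIr h2 oppr0.
Qed.

(* Surjectivity turns the covariant second derivative E2 b d into some D_k F, so
   that its product with the one in the directions ip, c is given by [koszul]. *)
Lemma mixed_term b c d : contact p b -> contact p c -> contact p d ->
  dot b c = 0 -> dot b d = 0 -> dot c d = 0 ->
  th b p = 0 -> th c p = 0 -> th d p = 0 ->
  2 * (dot (E2 (mulI p) c p) (E2 b d p)
   + rho ^+ 2 * (th (mulI p) p * dot (mulI (E c p)) (E2 b d p)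
      + dot (mulI (F p)) (E2 (mulI p) c p) * dot (mulI (F p)) (E2 b d p)))
  = rho ^+ 2 * (f1 b p * dot (mulI c) d + f1 d p * dot (mulI c) b).
Proof.
move=> [pb ipb] [pc ipc] [pd ipd] bc bd cd tb tc td.
have ipp : dot (mulI p) p = 0 by rewrite dot_mulI_self.
have pip : dot p (mulI p) = 0 by rewrite dotC.
have [pic ipic] : contact p (mulI c) by exact: contact_mulI.
have Hbd : hform p b d = 0 by rewrite /hform bd pb ipb; ring.
(* Since E b and E d are orthogonal, [E2 b d p] is tangent at F p and [surj] applies. *)
have Ebd : dot (F p) (E2 b d p) = 0.
  rewrite dot_F_E2//; have := conf b d p0; rewrite tb Hbd => h; lra.
have [k pk Ek] := surj Ebd.
have Kc := koszul b d c p0.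
have Ka := koszul b d (mulI p) p0.
have Kic := koszul b d (mulI c) p0.
have Cc := conf c k p0.
have Ca := conf (mulI p) k p0.
have Cic := conf (mulI c) k p0.
have K := koszul (mulI p) c k p0.
have db : dot d b = 0 by rewrite dotC.
have cb : dot c b = 0 by rewrite dotC.
have dc : dot d c = 0 by rewrite dotC.
have bic : dot b (mulI c) = - dot (mulI b) c by rewrite dot_mulIr.
have dic : dot d (mulI c) = - dot (mulI d) c by rewrite dot_mulIr.
have bip : dot b (mulI p) = 0 by rewrite dotC.
have dip : dot d (mulI p) = 0 by rewrite dotC.
have kc := dot_mulIC k c.
have dbC := dot_mulIC d b.
have dcC := dot_mulIC d c.
have bcC := dot_mulIC b c.
move: Kc Ka Kic Cc Ca Cic K; rewrite Ek tb tc td.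
rewrite !(dotC (E2 b d p)).
rewrite /hform /hform1 !dot_mulII.
rewrite !(pb, ipb, pc, ipc, pd, ipd, bc, bd, cd, db, cb, dc, ipp, pip, pic,
  ipic, p1, pk, bic, dic, bip, dip, kc, dbC, dcC, bcC, mulI_mulI, dotNl, dotNr).
set X := dot (E c p) _; set Y := dot (E (mulI p) p) _.
set Z := dot (E (mulI c) p) _.
move=> Kc Ka Kic Cc Ca Cic K.
(* The components of k along c and ip vanish, which reduces the right-hand side of [K] to 2 rho^2 fh
   <ic, k>. *)
have ck : dot c k = 0.
  have : fh p * dot c k = 0 by lra.
  by move/eqP; rewrite mulf_eq0 (negPf fh0) => /eqP.
have ipk : dot (mulI p) k = 0.
  have : fh p * (dot (mulI p) k * (1 + rho ^+ 2)) = 0 by lra.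
  move/eqP; rewrite !mulf_eq0 (negPf fh0) /= => /orP[/eqP//|/eqP].
  by have := sqr_ge0 rho => h1 h2; lra.
(* [Kic] and [Cic] determine fh <ic, k>, which occurs in [K] with a factor rho^2; scaling them by
   rho^2 keeps the conclusion a linear combination. *)
have := congr1 (fun t => rho ^+ 2 * t) Cic.
have := congr1 (fun t => rho ^+ 2 * t) Kic.
by move: K; rewrite ck ipk => K h1 h2; lra.
Qed.

(* The difference of second derivatives of the conformality relation that forms the
   Riemann tensor: third derivatives of F cancel, and on an orthogonal quadruple so
   do the Hessian of fh and the round part of the curvature. What is left is the
   Weyl tensor of the target on the image of (ip, b, c, d); the one of the source
   vanishes there because d eta (ip, .) = 0. *)
Lemma weyl_term b c d : contact p b -> contact p c -> contact p d ->
  dot b c = 0 -> dot b d = 0 -> dot c d = 0 ->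
  th b p = 0 -> th c p = 0 -> th d p = 0 -> rho != 0 ->
  2 * dot (mulI (E (mulI p) p)) (E b p) * dot (mulI (E c p)) (E d p)
  + dot (mulI (E (mulI p) p)) (E c p) * dot (mulI (E b p)) (E d p)
  - dot (mulI (E (mulI p) p)) (E d p) * dot (mulI (E b p)) (E c p) = 0.
Proof.
move=> cb cc cd bc bd cdo tb tc td rho0.
have dco : dot d c = 0 by rewrite dotC.
have M1 := mixed_term cb cc cd bc bd cdo tb tc td.
have M2 := mixed_term cb cd cc bd bc dco tb td tc.
set a := mulI p in M1 M2 *.
(* These are the four terms of d_b d_c g(a,d) + d_a d_d g(b,c) - d_a d_c g(b,d) - d_b d_d g(a,c),
   the leading part of the Riemann tensor. In it the dot products of [E2 a b] with [E2 c d] cancel;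
   those of the other two pairings are given by [M1] and [M2]. *)
have := conf2 b c a d p0.
have := conf2 a d b c p0.
have := conf2 a c b d p0.
have := conf2 b d a c p0.
case: cb cc cd => [pb ipb] [pc ipc] [pd ipd].
have ipp : dot a p = 0 by rewrite dot_mulI_self.
have pip : dot p a = 0 by rewrite dotC.
have ab : dot a b = 0 by [].
have ac : dot a c = 0 by [].
have ad : dot a d = 0 by [].
have ba : dot b a = 0 by rewrite dotC.
have ca : dot c a = 0 by rewrite dotC.
have da : dot d a = 0 by rewrite dotC.
have cb : dot c b = 0 by rewrite dotC.
have db : dot d b = 0 by rewrite dotC.
have aa : dot a a = 1 by rewrite /a dot_mulII.
have iaa u : dot p u = 0 -> dot (mulI a) u = 0.
  by rewrite mulI_mulI dotNl => ->; rewrite oppr0.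
have iaa' u : dot u p = 0 -> dot (mulI u) a = 0.
  by rewrite /a dot_mulII.
have bp : dot b p = 0 by rewrite dotC.
have cp : dot c p = 0 by rewrite dotC.
have dp : dot d p = 0 by rewrite dotC.
rewrite /hform /hform1 /hform2 tb tc td.
rewrite (E2C b a p0) (E2C c a p0) (E2C d a p0) (E2C d b p0) (E2C d c p0) (E2C c b p0).
rewrite (E3Cr b c a p0) (E3C b a c p0).
rewrite (E3Cr a d b p0).
rewrite (E3Cr a c b p0) (E3Cr b d a p0) (E3C b a d p0).
rewrite (E3Cr b d c p0) (E3Cr a d c p0).
rewrite !(pb, ipb, pc, ipc, pd, ipd, ab, ac, ad, ba, ca, da, cb, db, bc, bd, cdo, dco,
  aa, p1, ipp, pip, iaa b pb, iaa c pc, iaa d pd, iaa' b bp, iaa' c cp, iaa' d dp).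
rewrite (dot_mulIC (E b p) (E a p)) (dot_mulIC (E c p) (E a p)).
rewrite (dot_mulIC (E d p) (E a p)) (dot_mulIC (E d p) (E c p)).
rewrite (dot_mulIC (E c p) (E b p)) (dot_mulIC (E d p) (E b p)).
rewrite (dot_mulIC (E2 b d p) (E c p)) (dot_mulIC (E2 b c p) (E d p)).
rewrite (dotC (E2 b c p) (E2 a d p)) (dotC (E2 b d p) (E2 a c p)).
rewrite (dot_mulIC d c) (dot_mulIC d b).
move: M1 M2; rewrite (dot_mulIC d c) (dot_mulIC d b) (dot_mulIC c b).
move=> M1 M2 h4 h3 h2 h1.
set X := (X in X = 0).
have : rho ^+ 2 * X = 0 by rewrite /X; lra.
by move/eqP; rewrite mulf_eq0 expf_eq0 (negPf rho0) /= => /eqP.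
Qed.

(** Let e be the part of E (ip) orthogonal to F p and i F p; the claim is e = 0. The vectors put
    into [weyl_term] are chosen by their images, and conformality carries the required orthogonality
    and contact conditions back to the source. *)
Lemma reeb_image : (2 < n)%N -> rho != 0 ->
  E (mulI p) p = th (mulI p) p *: mulI (F p).
Proof.
move=> n2 rho0; set a := mulI p; set al := th a p.
apply/eqP; rewrite -subr_eq0; apply/negPn/negP => e0.
move: e0; set e := E a p - _ => e0.
have Ee : E a p = e + al *: mulI (F p) by rewrite subrK.
have Fp1 := F1 p0.
have ipp : dot p a = 0 by rewrite dotC dot_mulI_self.
have aa : dot a a = 1 by rewrite dot_mulII.
have Fe : dot (F p) e = 0.
  by rewrite dotDr dotNr dotZr dot_F_E// dot_mulIr dot_mulI_self; ring.
have iFe : dot (mulI (F p)) e = 0.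
  by rewrite dotDr dotNr dotZr dot_mulII Fp1 -/al; ring.
clearbody e.
(* The image of b is g_rho-orthogonal to E a = e + al i F, hence b is g_rho-orthogonal to ip; the
   factor 1 + rho^2 is g_rho(ip, ip). *)
have pre b w : E b p = w -> dot p b = 0 -> contact (F p) w -> dot w e = 0 ->
    contact p b.
  move=> Eb pb [Fw iFw] we; split=> //.
  have := conf b a p0; rewrite Eb Ee iFw dotDr dotZr we.
  rewrite (dotC w) iFw /hform p1 pb ipp aa => h.
  have : fh p * (dot (mulI p) b * (1 + rho ^+ 2)) = 0.
    by move: h; rewrite (dotC b) -/a => h; lra.
  move/eqP; rewrite !mulf_eq0 (negPf fh0) /= => /orP[/eqP//|/eqP].
  by have := sqr_ge0 rho => h1 h2; lra.
have ort b c : contact p b -> th b p = 0 -> dot (E b p) (E c p) = 0 ->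
    dot b c = 0.
  move=> [pb ipb] tb bc; have := conf b c p0; rewrite bc tb /hform p1 pb ipb.
  move=> h; have : fh p * dot b c = 0 by lra.
  by move/eqP; rewrite mulf_eq0 (negPf fh0) => /eqP.
have [u u0 [Fu iFu eu ieu]] := exists_dot_orthogonal (F p) e n2.
have ce : contact (F p) e by [].
have cu : contact (F p) u by [].
have [Fie iFie] := contact_mulI ce.
have [Fiu iFiu] := contact_mulI cu.
(* On the quadruple of images (E a, ie, u, iu) the Weyl tensor is 2 |e|^2 |u|^2. *)
have [b pb Eb] := surj Fie.
have [c pc Ec] := surj Fu.
have [d pd Ed] := surj Fiu.
have ue : dot u e = 0 by rewrite dotC.
have iue : dot (mulI u) e = 0 by rewrite dot_mulIC ieu oppr0.
have cb : contact p b by apply: pre Eb pb _ _ => //; exact: dot_mulI_self.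
have cc : contact p c by exact: pre Ec pc _ _.
have cd : contact p d by exact: pre Ed pd _ _.
have tb : th b p = 0 by rewrite Eb.
have tc : th c p = 0 by rewrite Ec.
have td : th d p = 0 by rewrite Ed.
have bc : dot b c = 0 by apply: ort => //; rewrite Eb Ec.
have bd : dot b d = 0 by apply: ort => //; rewrite Eb Ed dot_mulII.
have cd' : dot c d = 0.
  by apply: ort => //; rewrite Ec Ed dotC dot_mulI_self.
have := weyl_term cb cc cd bc bd cd' tb tc td rho0.
rewrite -/a Eb Ec Ed Ee !dot_mulII mulID mulIZ mulI_mulI.
rewrite !(dotDl, dotZl, dotNl) ieu eu Fu iFu iFe => h.
have : dot e e * dot u u = 0 by lra.
by move/eqP; rewrite mulf_eq0 !dot_eq0 (negPf e0) (negPf u0).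
Qed.

(** Among tangent vectors the contact hyperplane is the g_rho-orthogonal complement of the Reeb
    direction, and conformal maps preserve orthogonality. The coefficient [al] is nonzero because
    g_rho of E (ip) with itself is fh (1 + rho^2). *)
Lemma contact_image v : (2 < n)%N -> rho != 0 -> contact p v -> th v p = 0.
Proof.
move=> n2 rho0 [pv ipv]; have Ea := reeb_image n2 rho0.
have aa : dot (mulI p) (mulI p) = 1 by rewrite dot_mulII.
have ipp : dot p (mulI p) = 0 by rewrite dotC dot_mulI_self.
have := conf v (mulI p) p0; have := conf (mulI p) (mulI p) p0.
rewrite Ea; set al := th (mulI p) p.
rewrite /hform p1 ipp aa (dotC v) ipv pv !(dotZr, dotZl) !dot_mulII (F1 p0).
rewrite (dotC (E v p)) => h1 h2.
have r2 := sqr_ge0 rho.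
have r1 : 1 + rho ^+ 2 != 0 by rewrite gt_eqF//; lra.
have al0 : al != 0.
  apply/eqP => al0; have : fh p * (1 + rho ^+ 2) = 0 by move: h1; rewrite al0; lra.
  by move/eqP; rewrite mulf_eq0 (negPf fh0) (negPf r1).
have : al * (1 + rho ^+ 2) * th v p = 0 by lra.
by move/eqP; rewrite !mulf_eq0 (negPf al0) (negPf r1) => /eqP.
Qed.

End Pointwise.

Lemma hermitian_image p z v : p != 0 ->
  (forall x w, x != 0 -> contact x w -> th w x = 0) ->
  contact p z -> contact p v -> dot z v = 0 -> dot (mulI z) v = 0 ->
  dot (mulI (E z p)) (E v p) = 0.
Proof.
move=> p0 H cz cv zv izv.
(* w remains in the contact hyperplane along the line p + t u, so F^* eta (w) is
   constantly 0 there; the antisymmetric part of its derivative is d eta. *)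
have key u w : contact p u -> contact p w -> dot u w = 0 ->
    dot (mulI u) w = 0 -> th1 u w p = 0.
  move=> [pu ipu] [pw ipw] uw iuw.
  have d1 : is_derive p u (fun x => th w x) (th1 u w p).
    by eapply is_derive_eq; [der|].
  have line : is_derive (0 : R) 1 (fun t => th w (p + t *: u)) (th1 u w p).
    by apply: (is_derive_line (f := fun x => th w x)); rewrite scale0r addr0.
  have zero : is_derive (0 : R) 1 (fun t => th w (p + t *: u)) 0.
    rewrite [X in is_derive _ _ X _](_ : _ = cst 0); first exact: is_derive_cst.
    apply/funext => t; apply: H.
      apply/eqP => h; have := congr1 (dot p) h.
      rewrite dotDr dotZr pu dot0r mulr0 addr0 => /eqP.
      by rewrite dot_eq0 (negPf p0).
    split; rewrite ?mulID ?mulIZ dotDl dotZl ?pw ?ipw ?uw ?iuw mulr0 addr0//.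
  by have [_ <-] := line; have [_ ?] := zero.
have k1 := key z v cz cv zv izv.
have := key v z cv cz; rewrite dotC dot_mulIC izv oppr0 => /(_ zv erefl).
rewrite (E2C v z p0) (dot_mulIC (E v p)) => k2.
lra.
Qed.

End Koszul.

(** * Smooth functions on the punctured space and the radial extension *)

Section NearDifferentiable.
Context {R : realType} {V W : normedModType R}.

Lemma near0_differentiable (h : V -> W) x :
  (\forall y \near x, h y = 0) -> differentiable h x.
Proof.
move=> h0; have hx : h x = 0 by exact: nbhs_singleton h0.
have e : h \o shift x = cst (h x) + \0 +o_ (0 : V) id.
  apply/eqaddoP => eps eps0; rewrite hx.
  have : \forall y \near (0 : V), h (y + x) = 0.
    have := h0; rewrite (near_shift 0 x); apply: filterS => y /=.
    by rewrite subr0.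
  apply: filterS => y hy; rewrite /= !fctE /= hy.
  by rewrite addr0 subr0 normr0 mulr_ge0 // ltW.
apply/diff_locallyP; rewrite (diff_unique (df := \0) _ e); last exact: cst_continuous.
by split=> //; exact: cst_continuous.
Qed.

(** [g] is [f] plus a function that vanishes near x. *)
Lemma near_eq_differentiable (f g : V -> W) x :
  (\forall y \near x, f y = g y) -> differentiable f x -> differentiable g x.
Proof.
move=> fg df; rewrite (_ : g = f + (g - f)); last first.
  by apply/funext => y; rewrite !fctE addrC subrK.
apply: differentiableD; first exact: df.
apply: near0_differentiable.
by apply: filterS fg => y fgy; rewrite !fctE fgy subrr.
Qed.

End NearDifferentiable.

Lemma differentiable_coordP {R : realType} {V : normedModType R} {m : nat}
    (F : V -> 'rV[R]_m) x :
  (forall i, differentiable (fun y => F y 0 i : R) x) -> differentiable F x.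
Proof.
move=> h; rewrite (_ : F = \sum_i (fun y => F y 0 i *: delta_mx 0 i)).
  by apply: differentiable_sum => i; exact: differentiableZl.
by apply/funext => y; rewrite fct_sumE -row_sum_delta.
Qed.

Section RadialClass.
Context {R : realType} {n : nat}.
Implicit Types x y v : Cn R n.

Lemma enorm_gt0 x : x != 0 -> 0 < enorm x.
Proof. by move=> x0; rewrite sqrtr_gt0 dot_gt0. Qed.

Lemma sqr_enorm x : enorm x ^+ 2 = dot x x.
Proof. by rewrite sqr_sqrtr// dot_ge0. Qed.

(* An algebra of functions that are differentiable off the origin and whose
   derivatives agree there with functions of the same class. *)
Inductive radial_class : (Cn R n -> R) -> Prop :=
| radial_cst c : radial_class (fun=> c)
| radial_coord i : radial_class (fun x => x 0 i)
| radial_smooth f : smooth_on punctured f -> radial_class f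
| radial_inv : radial_class (fun x => (enorm x)^-1)
| radial_add f g : radial_class f -> radial_class g ->
    radial_class (fun x => f x + g x)
| radial_mul f g : radial_class f -> radial_class g ->
    radial_class (fun x => f x * g x).

Lemma radial_sum (I : Type) (s : seq I) (f : I -> Cn R n -> R) :
  (forall i, radial_class (f i)) -> radial_class (fun x => \sum_(i <- s) f i x).
Proof.
move=> h; elim: s => [|i s IH].
  by rewrite (_ : (fun _ => _) = (fun=> 0));
    [exact: radial_cst|apply/funext => x; rewrite big_nil].
rewrite (_ : (fun _ => _) = (fun x => f i x + \sum_(j <- s) f j x)).
  exact: radial_add.
by apply/funext => x; rewrite big_cons.
Qed.

Lemma radial_dot v : radial_class (fun x => dot x v).
Proof.
apply: radial_sum => i; apply: radial_mul; first exact: radial_coord.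
exact: radial_cst.
Qed.

Lemma differentiable_dot x : differentiable (fun x : Cn R n => dot x x) x.
Proof.
rewrite (_ : (fun _ => _) =
  \sum_(i < n + n) ((fun y => y 0 i) * (fun y => y 0 i))).
  by apply: differentiable_sum => i; apply: differentiableM;
    exact: differentiable_coord.
by apply/funext => y; rewrite fct_sumE.
Qed.

Lemma differentiable_enormV x : x != 0 ->
  differentiable (fun x => (enorm x)^-1 : R) x.
Proof.
move=> x0.
have dd := differentiable_dot x.
have ds : differentiable (Num.sqrt : R -> R) (dot x x).
  by apply/derivable1_diffP; case: (is_derive1_sqrt (dot_gt0 x0)).
have de : differentiable (fun x : Cn R n => enorm x) x.
  exact: (differentiable_comp dd ds).
by apply: (differentiableV de); rewrite gt_eqF// enorm_gt0.
Qed.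

Lemma radial_differentiable f x : radial_class f -> x != 0 ->
  differentiable f x.
Proof.
move=> rf x0; elim: rf => [c|i|g sg||g h _ IHg _ IHh|g h _ IHg _ IHh].
- exact: differentiable_cst.
- exact: differentiable_coord.
- exact: smooth_on_differentiable.
- exact: differentiable_enormV.
- exact: differentiableD.
- exact: differentiableM.
Qed.

(** Obtained by differentiating |x|^-2 <x, x> = 1 and solving for the derivative. The value is
    spelled as a product of inverses so that it visibly belongs to [radial_class]. *)
Lemma is_derive_enormV x v : x != 0 ->
  is_derive x v (fun x => (enorm x)^-1 : R)
    (-1 * (dot x v * ((enorm x)^-1 * ((enorm x)^-1 * (enorm x)^-1)))).
Proof.
move=> x0; set e := fun x => _; set d := (X in is_derive _ _ _ X).
have de : is_derive x v e ('D_v e x).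
  by apply: derivableP; apply: diff_derivable; exact: differentiable_enormV.
have hl := is_derive_mul (is_derive_mul de de)
  (is_derive_dot (is_derive_id x v) (is_derive_id x v)).
have hr : is_derive x v (fun _ : Cn R n => 1 : R) 0 by exact: is_derive_cst.
have h : forall y : Cn R n, y != 0 -> e y * e y * dot (id y) (id y) = 1.
  move=> y y0; rewrite -sqr_enorm /e /= expr2 mulrACA mulVf ?mulr1 //.
  by rewrite gt_eqF// enorm_gt0.
have := is_derive_unique x0 hl hr h.
move: ('D_v e x) de => D de hD.
suff -> : d = D by [].
have ex : enorm x != 0 by rewrite gt_eqF// enorm_gt0.
move: hD; rewrite /= (dotC v) -sqr_enorm /d /e.
move: (enorm x) ex (dot x v) => N N0 s hD.
have N2 : 2 * N != 0 by rewrite mulf_neq0// pnatr_eq0.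
apply: (mulfI N2).
have -> : 2 * N * D = N ^+ 2 * (N^-1 * D + N^-1 * D) by field.
have -> : 2 * N * (-1 * (s * (N^-1 * (N^-1 / N)))) = - (N^-1 / N * (s + s)) by field.
by apply/eqP; rewrite eq_sym -addr_eq0 addrC hD.
Qed.

Lemma radial_is_derive f v : radial_class f ->
  exists2 g, radial_class g & forall x, x != 0 -> is_derive x v f (g x).
Proof.
elim=> [c|i|g sg||g h rg [g' rg' dg] rh [h' rh' dh]|g h rg [g' rg' dg] rh [h' rh' dh]].
- exists (fun=> 0); first exact: radial_cst.
  by move=> x _; exact: is_derive_cst.
- exists (fun=> v 0 i); first exact: radial_cst.
  by move=> x _; exact: ((is_derive_coordP _ _ _ _).1 (is_derive_id x v) i).
- exists ('D_v g); first by apply: radial_smooth; exact: smooth_on_derive.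
  by move=> x x0; exact: smooth_on_is_derive.
- eexists; last by move=> x x0; exact: is_derive_enormV.
  apply: radial_mul; first exact: radial_cst.
  apply: radial_mul; first exact: radial_dot.
  by do ?apply: radial_mul; exact: radial_inv.
- exists (fun x => g' x + h' x); first exact: radial_add.
  by move=> x x0; apply: is_derive_add; [exact: dg|exact: dh].
- exists (fun x => g x * h' x + h x * g' x).
    by apply: radial_add; exact: radial_mul.
  by move=> x x0; apply: is_derive_mul; [exact: dg|exact: dh].
Qed.

Lemma radial_is_derive1 f v x : radial_class f -> x != 0 ->
  is_derive x v f ('D_v f x).
Proof.
move=> rf x0; have [g rg dg] := radial_is_derive v rf.
by apply: derivableP; case: (dg x x0).
Qed.

Lemma radial_is_derive2 f v w x : radial_class f -> x != 0 ->
  is_derive x w ('D_v f) ('D_w ('D_v f) x).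
Proof.
move=> rf x0; have [g rg dg] := radial_is_derive v rf.
have [h _ dh] := radial_is_derive w rg.
have : is_derive x w ('D_v f) (h x).
  apply: is_derive_punctured x0 _ (dh x x0) => y y0.
  by case: (dg y y0).
by case=> d _; exact: derivableP.
Qed.

(** Agreement is asked only off the origin, where derivatives are under control; in this form the
    property passes to derivatives. *)
Definition radial_on_punctured {m} (F : Cn R n -> 'rV[R]_m) :=
  forall i, exists2 g, radial_class g & forall x, x != 0 -> F x 0 i = g x.

Lemma radial_on_derive m (F : Cn R n -> 'rV[R]_m) v :
  radial_on_punctured F -> radial_on_punctured ('D_v F).
Proof.
move=> rF i; have [g rg Fg] := rF i.
have [g' rg' dg] := radial_is_derive v rg; exists g' => // x x0.
have dF : is_derive x v F ('D_v F x).
  apply: derivableP; apply/derivable_mxP => i0 j; rewrite (ord1 i0).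
  have [h rh Fh] := rF j; have [h' _ dh] := radial_is_derive v rh.
  have : is_derive x v (fun x => F x 0 j) (h' x).
    by apply: is_derive_punctured x0 _ (dh x x0) => y y0; rewrite Fh.
  by case.
have dFi := (is_derive_coordP _ _ _ _).1 dF i.
exact: is_derive_unique x0 dFi (dg x x0) Fg.
Qed.

Lemma radial_on_differentiable m (F : Cn R n -> 'rV[R]_m) x :
  radial_on_punctured F -> x != 0 -> differentiable F x.
Proof.
move=> rF x0; apply: differentiable_coordP => i.
have [g rg Fg] := rF i.
apply: (near_eq_differentiable _ (radial_differentiable rg x0)).
by apply: filterS (near_punctured x0) => y y0; rewrite Fg.
Qed.

Lemma radial_on_smooth m (F : Cn R n -> 'rV[R]_m) :
  radial_on_punctured F -> smooth_on punctured F.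
Proof.
move=> rF s x x0; apply: radial_on_differentiable => //.
by elim: s => // v s IH; exact: radial_on_derive.
Qed.

(** * The radial retraction and radial extensions *)

Definition retraction x : Cn R n := (enorm x)^-1 *: x.

Lemma retraction_smooth : smooth_on punctured retraction.
Proof.
apply: radial_on_smooth => i; exists (fun x => (enorm x)^-1 * x 0 i).
  by apply: radial_mul; [exact: radial_inv|exact: radial_coord].
by move=> x x0; rewrite mxE.
Qed.

Lemma dot_retraction x : x != 0 -> dot (retraction x) (retraction x) = 1.
Proof.
move=> x0; rewrite dotZl dotZr -sqr_enorm; field.
by rewrite gt_eqF// enorm_gt0.
Qed.

Lemma retractionZ (c : R) x : 0 < c -> retraction (c *: x) = retraction x.
Proof.
move=> c0; rewrite /retraction /enorm dotZl dotZr mulrA -expr2.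
rewrite sqrtrM ?sqr_ge0// sqrtr_sqr gtr0_norm// invfM scalerA mulrC mulrA.
by rewrite mulfV ?mul1r// gt_eqF.
Qed.

Lemma sphereP (u : sphere R n) : dot (\val u) (\val u) = 1.
Proof. by apply/eqP; exact: (valP u). Qed.

Lemma sphere_neq0 (u : sphere R n) : \val u != 0.
Proof.
by apply/eqP => u0; have := sphereP u; rewrite u0 dot0l => /esym/eqP; rewrite oner_eq0.
Qed.

Lemma retraction_id x : dot x x = 1 -> retraction x = x.
Proof. by move=> x1; rewrite /retraction /enorm x1 sqrtr1 invr1 scale1r. Qed.

(** Off the origin the [insub] in [radial_ext] succeeds, so its default 0 does not occur. The point
    u is chosen before V and f and thus serves several extensions at once. *)
Lemma radial_extE x : x != 0 -> exists2 u : sphere R n, \val u = retraction x &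
  forall (V : normedModType R) (f : sphere R n -> V), radial_ext f x = f u.
Proof.
move=> x0; have h : dot (retraction x) (retraction x) == 1.
  by apply/eqP; exact: dot_retraction.
exists (Sub (retraction x) h); first by rewrite SubK.
by move=> V f; rewrite /radial_ext -/(retraction x) insubT.
Qed.

Lemma radial_ext_sphere (V : normedModType R) (f : sphere R n -> V) u :
  radial_ext f (\val u) = f u.
Proof.
have [w wu ->] := radial_extE (sphere_neq0 u).
congr f; apply: val_inj; rewrite wu retraction_id//; exact: sphereP.
Qed.

Lemma radial_extZ (V : normedModType R) (f : sphere R n -> V) (c : R) x :
  0 < c -> radial_ext f (c *: x) = radial_ext f x.
Proof.
by move=> c0; rewrite /radial_ext -!/(retraction _) retractionZ.
Qed.

End RadialClass.

(** * Conformal maps of g_rho *)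

Section SphereMap.
Context {R : realType} {n : nat} (psi : sphere R n -> sphere R n).
Hypothesis spsi : smooth_map psi.
Implicit Types x v w : Cn R n.

Local Notation F := (radial_ext (\val \o psi : sphere R n -> Cn R n)).

Lemma dot_radial_ext x : x != 0 -> dot (F x) (F x) = 1.
Proof.
by move=> x0; have [u _ ->] := radial_extE x0; exact: sphereP.
Qed.

Lemma derive_radial_extZ (c : R) x v : 0 < c -> x != 0 ->
  'D_v F (c *: x) = c^-1 *: 'D_v F x.
Proof.
move=> c0 x0; have cn0 : c != 0 by rewrite gt_eqF.
have cx0 : c *: x != 0 by rewrite scaler_eq0 negb_or cn0.
have e : 'D_(c *: v) F (c *: x) = 'D_v F x.
  have E : (fun h => h^-1 *: (F (h *: (c *: v) + c *: x) - F (c *: x)))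
      = (fun h => h^-1 *: (F (h *: v + x) - F x)).
    apply/funext => h; rewrite -(radial_extZ _ (h *: v + x) c0) [c *: (_ + _)]scalerDr.
    by rewrite !scalerA (mulrC c) (radial_extZ _ x c0).
  by rewrite /derive /= E.
have dF : differentiable F (c *: x) by exact: smooth_on_differentiable.
move: (deriveZv c v dF) e; generalize ('D_(c *: v) F (c *: x)).
generalize ('D_v F (c *: x)) ('D_v F x) => a b d -> <-.
by rewrite scalerA (mulVf cn0) scale1r.
Qed.

Lemma derive_radial_ext_self x : x != 0 -> 'D_x F x = 0.
Proof.
move=> x0.
have dF : is_derive x x F ('D_x F x) by exact: smooth_on_is_derive.
have line : is_derive (0 : R) 1 (fun t => F (x + t *: x)) ('D_x F x).
  by apply: (is_derive_line (f := F)); rewrite scale0r addr0.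
have cst0 : is_derive (0 : R) 1 (fun=> F x) 0 by exact: is_derive_cst.
apply: (is_derive_unique_near line cst0).
have : \forall t \near (0 : R), - 1 < t by apply: lt_nbhsr; rewrite ltrN10.
apply: filterS => t t1.
by rewrite -{1}(scale1r x) -scalerDl radial_extZ// -ltrBlDl sub0r.
Qed.

End SphereMap.

Section ConformalMap.
Context {R : realType} {n : nat} (rho : R) (psi phi : sphere R n -> sphere R n)
  (f : sphere R n -> R).
Hypothesis spsi : smooth_map psi.
Hypothesis sphi : smooth_map phi.
Hypothesis phiK : cancel phi psi.
Hypothesis psiK : cancel psi phi.
Hypothesis sf : smooth_sphere (f : sphere R n -> R^o).
Hypothesis f0 : forall u, 0 < f u.
Hypothesis conf : forall u v w, tangent u v -> tangent u w ->
  pullback psi (g_rho rho) u v w = f u * g_rho rho u v w.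
Implicit Types x v w : Cn R n.

Local Notation F := (radial_ext (\val \o psi : sphere R n -> Cn R n)).
Local Notation G := (radial_ext (\val \o phi : sphere R n -> Cn R n)).

Definition conf_factor x : R := radial_ext (f : sphere R n -> R^o) x *
  ((enorm x)^-1 * (enorm x)^-1 * ((enorm x)^-1 * (enorm x)^-1)).

Lemma conf_factor_radial : radial_class conf_factor.
Proof.
apply: radial_mul; first exact: radial_smooth.
by do 2 apply: radial_mul; exact: radial_inv.
Qed.

Lemma conf_factor_gt0 x : x != 0 -> 0 < conf_factor x.
Proof.
move=> x0; have [u _ E] := radial_extE x0.
by rewrite /conf_factor E !mulr_gt0// invr_gt0 enorm_gt0.
Qed.

Lemma polar x : x != 0 -> exists2 r : R, 0 < r &
  exists u : sphere R n, x = r *: \val u.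
Proof.
move=> x0; have [u ux _] := radial_extE x0; have r0 := enorm_gt0 x0.
exists (enorm x) => //; exists u.
by rewrite ux scalerA mulfV ?scale1r// gt_eqF.
Qed.

(** Write x = r u with u on the sphere. The radial parts of v and w are killed by dF, homogeneity
    contributes a factor r^-1 per derivative, and conformality at u applies to the tangential
    parts. *)
Lemma conf_punctured x v w : x != 0 ->
  dot ('D_v F x) ('D_w F x)
  + rho ^+ 2 * (dot (mulI (F x)) ('D_v F x) * dot (mulI (F x)) ('D_w F x))
  = conf_factor x * hform rho x v w.
Proof.
move=> x0; have [r r0 [u xu]] := polar x0; subst x.
have rn0 : r != 0 by rewrite gt_eqF.
have u1 := sphereP u.
have u0 := sphere_neq0 u.
have dF : differentiable F (\val u) by exact: smooth_on_differentiable.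
pose tan v := v - dot (\val u) v *: \val u.
have tanP v' : tangent u (tan v').
  by rewrite /tangent /= dotDr dotNr dotZr u1 mulr1 subrr.
have Dtan v' : 'D_v' F (r *: \val u) = r^-1 *: 'D_(tan v') F (\val u).
  apply: (etrans (derive_radial_extZ spsi v' r0 u0)); apply: congr1.
  have := deriveDv (tan v') (dot (\val u) v' *: \val u) dF.
  by rewrite (deriveZv _ _ dF) (derive_radial_ext_self spsi u0) scaler0 addr0 subrK.
have Fx : F (r *: \val u) = \val (psi u) by rewrite radial_extZ// radial_ext_sphere.
have h : dot ('D_(tan v) F (\val u)) ('D_(tan w) F (\val u)) +
    rho ^+ 2 * (dot (mulI (\val (psi u))) ('D_(tan v) F (\val u)) *
                dot (mulI (\val (psi u))) ('D_(tan w) F (\val u)))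
    = f u * (dot (tan v) (tan w) + rho ^+ 2 *
        (dot (mulI (\val u)) (tan v) * dot (mulI (\val u)) (tan w))).
  exact: (conf (tanP v) (tanP w)).
have fE : conf_factor (r *: \val u) = f u * (r^-1 * r^-1 * (r^-1 * r^-1)).
  have en : enorm (r *: \val u) = r.
    by rewrite /enorm dotZl dotZr u1 mulr1 -expr2 sqrtr_sqr gtr0_norm.
  by rewrite /conf_factor en radial_extZ// radial_ext_sphere.
move: Fx h (Dtan v) (Dtan w); rewrite fE.
generalize (F (r *: \val u)) ('D_v F (r *: \val u)) ('D_w F (r *: \val u)).
generalize ('D_(tan v) F (\val u)) ('D_(tan w) F (\val u)).
move=> a b y c d -> h -> ->; rewrite !(dotZl, dotZr).
transitivity (r^-1 * r^-1 * (f u * (dot (tan v) (tan w) + rho ^+ 2 *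
   (dot (mulI (\val u)) (tan v) * dot (mulI (\val u)) (tan w))))).
  rewrite -h; ring.
rewrite /hform /tan !(mulIZ, dotDl, dotDr, dotNl, dotNr, dotZl, dotZr) u1.
by rewrite dot_mulI_self (dotC v (\val u)); field.
Qed.

Lemma derive_retraction (u : sphere R n) v : dot (\val u) v = 0 ->
  'D_v (@retraction R n) (\val u) = v.
Proof.
move=> uv.
have e1 : enorm (\val u) = 1 by rewrite /enorm sphereP sqrtr1.
suff : is_derive (\val u) v (@retraction R n) v by case.
apply/is_derive_coordP => i.
have h := is_derive_mul (is_derive_enormV v (sphere_neq0 u))
  ((is_derive_coordP _ _ _ _).1 (is_derive_id (\val u) v) i).
apply: is_derive_fun h _ _ => [y|]; first by rewrite mxE.
by rewrite /= uv e1; field.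
Qed.

(** The preimage is given by the differential of the inverse map: F o G is the radial retraction off
    the origin, and its differential fixes tangent vectors. *)
Lemma conf_surj (u : sphere R n) v : dot (F (\val u)) v = 0 ->
  exists2 k, dot (\val u) k = 0 & 'D_k F (\val u) = v.
Proof.
rewrite radial_ext_sphere /= => uv.
have Gu : G (\val (psi u)) = \val u by rewrite radial_ext_sphere /= psiK.
have dG : differentiable G (\val (psi u)).
  by apply: smooth_on_differentiable => //; exact: sphere_neq0.
have dF : differentiable F (G (\val (psi u))).
  by rewrite Gu; apply: smooth_on_differentiable => //; exact: sphere_neq0.
exists ('D_v G (\val (psi u))).
  rewrite -[X in dot X _]Gu.
  apply: (dot_F_E (F := G) (E := fun v => 'D_v G)); last exact: sphere_neq0.
    by move=> x k x0; exact: smooth_on_is_derive.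
  by move=> x; exact: dot_radial_ext.
have FG x : x != 0 -> (F \o G) x = retraction x.
  move=> x0; have [w wx E] := radial_extE x0.
  by rewrite /= E /= radial_ext_sphere /= phiK.
have dFG : differentiable (F \o G) (\val (psi u)) by exact: differentiable_comp.
have e1 : 'D_v (F \o G) (\val (psi u)) = v.
  apply: (etrans _ (derive_retraction uv)); apply: near_eq_derive.
  by apply: filterS (near_punctured (sphere_neq0 (psi u))) => x; exact: FG.
have e2 : 'D_v (F \o G) (\val (psi u)) =
    'D_('D_v G (\val (psi u))) F (G (\val (psi u))).
  apply: (etrans (deriveE _ dFG)); apply: (etrans _ (esym (deriveE _ dF))).
  apply: (etrans (congr1 (@^~ v) (diff_comp dG dF))).
  exact: (congr1 ('d F (G (\val (psi u)))) (esym (deriveE _ dG))).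
apply: (etrans _ e1); apply: (etrans _ (esym e2)); by rewrite Gu.
Qed.

Hypothesis n2 : (2 < n)%N.
Hypothesis rho0 : rho != 0.

Let dE x v : x != 0 -> is_derive x v F ('D_v F x).
Proof. exact: smooth_on_is_derive. Qed.

Let dE2 x z v : x != 0 -> is_derive x z ('D_v F) ('D_z ('D_v F) x).
Proof. by apply: smooth_on_is_derive; exact: smooth_on_derive. Qed.

Let dE3 x y z v : x != 0 ->
  is_derive x y ('D_z ('D_v F)) ('D_y ('D_z ('D_v F)) x).
Proof. by apply: smooth_on_is_derive; do 2 apply: smooth_on_derive. Qed.

Let E2C x z v : x != 0 -> 'D_z ('D_v F) x = 'D_v ('D_z F) x.
Proof. exact: schwarz_Cn. Qed.

Let E3C x y z v : x != 0 ->
  'D_y ('D_z ('D_v F)) x = 'D_z ('D_y ('D_v F)) x.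
Proof. by apply: schwarz_Cn; exact: smooth_on_derive. Qed.

Let df1 x z : x != 0 -> is_derive x z conf_factor ('D_z conf_factor x).
Proof. exact: radial_is_derive1 conf_factor_radial. Qed.

Let df2 x y z : x != 0 ->
  is_derive x y ('D_z conf_factor) ('D_y ('D_z conf_factor) x).
Proof. exact: radial_is_derive2 conf_factor_radial. Qed.

Lemma conf_contact_sphere (u : sphere R n) v : contact (\val u) v ->
  dot (mulI (F (\val u))) ('D_v F (\val u)) = 0.
Proof.
have fu : conf_factor (\val u) != 0.
  by rewrite gt_eqF// conf_factor_gt0// sphere_neq0.
exact: (contact_image dE dE2 dE3 E2C E3C (dot_radial_ext psi) df1 df2
  conf_punctured (sphereP u) fu (@conf_surj u) n2 rho0).
Qed.

(** Homogeneity extends the statement off the sphere, as [hermitian_image] requires: it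
    differentiates along a straight line, which leaves the sphere. *)
Lemma conf_contact x v : x != 0 -> contact x v ->
  dot (mulI (F x)) ('D_v F x) = 0.
Proof.
move=> x0; have [r r0 [u xu]] := polar x0; subst x => -[].
have rn0 : r != 0 by rewrite gt_eqF.
rewrite mulIZ !dotZl => /eqP; rewrite mulf_eq0 (negPf rn0) => /eqP uv.
move=> /eqP; rewrite mulf_eq0 (negPf rn0) => /eqP iuv.
rewrite (derive_radial_extZ spsi v r0 (sphere_neq0 u)) (radial_extZ _ _ r0) dotZr.
by rewrite (conf_contact_sphere (conj uv iuv)) mulr0.
Qed.

Lemma conf_hermitian (u : sphere R n) z v :
  contact (\val u) z -> contact (\val u) v -> dot z v = 0 ->
  dot (mulI z) v = 0 ->
  dot ('D_z F (\val u)) ('D_v F (\val u)) = 0 /\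
  dot (mulI ('D_z F (\val u))) ('D_v F (\val u)) = 0.
Proof.
move=> cz cv zv izv; split; last first.
  exact: (hermitian_image dE dE2 E2C (sphere_neq0 u) conf_contact).
move: (conf_punctured z v (sphere_neq0 u)) (conf_contact_sphere cz).
generalize (F (\val u)) ('D_z F (\val u)) ('D_v F (\val u)) => y a b h t.
move: h; rewrite t mul0r mulr0 addr0 => ->.
case: cz cv => pz ipz [pv ipv].
by rewrite /hform zv pz ipz !(mul0r, mulr0) subr0 addr0 mulr0.
Qed.

Lemma conf_derive_neq0 (u : sphere R n) v : contact (\val u) v -> v != 0 ->
  'D_v F (\val u) != 0.
Proof.
move=> cv v0; have := conf_punctured v v (sphere_neq0 u).
rewrite (conf_contact_sphere cv) mul0r mulr0 addr0.
case: cv => pv ipv; rewrite /hform sphereP pv ipv !(mul0r, mulr0) mul1r subr0 addr0.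
move=> h; rewrite -dot_eq0 h mulf_neq0 ?gt_eqF ?dot_gt0//.
by rewrite conf_factor_gt0// sphere_neq0.
Qed.

End ConformalMap.

(** * The topology of the space of maps *)

Section SphereMapTopology.
Context {R : realType} {n : nat}.

Local Notation jet_space :=
  (prod_topology (fun _ : seq (Cn R n) => {uniform sphere R n -> Cn R n})).

Lemma sphere_map_eval_continuous (s : seq (Cn R n)) (u : sphere R n) :
  continuous (fun psi : @sphere_map R n =>
    sphere_iter_derive (\val \o psi) s u : Cn R n).
Proof.
move=> psi.
have cj : continuous (@sphere_jets R n : @sphere_map R n -> jet_space).
  exact: initial_continuous.
have cp : continuous (fun g : jet_space => g s : {uniform sphere R n -> Cn R n}).
  exact: (@proj_continuous _
    (fun _ : seq (Cn R n) => {uniform sphere R n -> Cn R n}) s).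
have ce : continuous (fun g : {uniform sphere R n -> Cn R n} => g u).
  move=> g; have /(uniform_subset_cvg _ (@subsetT _ [set u])) :
    {uniform, nbhs (g : {uniform sphere R n -> Cn R n}) --> (g : sphere R n -> Cn R n)}.
    exact: cvg_id.
  by rewrite uniform_set1.
apply: (@continuous_comp _ _ _ (@sphere_jets R n : @sphere_map R n -> jet_space)
  (fun g : jet_space => g s u)); first exact: cj.
apply: (@continuous_comp _ _ _
  (fun g : jet_space => g s : {uniform sphere R n -> Cn R n})
  (fun g : {uniform sphere R n -> Cn R n} => g u)).
  exact: cp.
exact: ce.
Qed.

(** The topology is initial for a product of uniform spaces, so each list s of directions can be
    treated separately. *)
Lemma continuous_sphere_map (T : topologicalType) (gamma : T -> @sphere_map R n) :
  (forall s t (e : R), 0 < e -> \forall t' \near t, forall u,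
     `|sphere_iter_derive (\val \o gamma t) s u
       - sphere_iter_derive (\val \o gamma t') s u| < e) ->
  continuous gamma.
Proof.
move=> h; apply: continuous_comp_initial => t.
apply/cvg_sup => s; apply/cvg_image.
  by rewrite eqEsubset; split=> v // _; exists (fun=> v).
move=> P /= /uniform_nbhs [E [+ sub]].
rewrite -entourage_from_ballE => -[e /= e0 eE].
exists ((fun f : jet_space => f s) @^-1` P); last first.
  apply: image_preimage; rewrite eqEsubset; split=> [//|v _].
  by exists (fun=> v).
apply: filterS (h s t e e0) => t' ht' /=; apply: sub => u _; apply: eE.
by rewrite -ball_normE /=; exact: ht'.
Qed.

End SphereMapTopology.

(** * The Hopf circle action *)

Section Rotation.
Context {R : realType} {n : nat}.
Implicit Types x v w : Cn R n.

(* the action of the complex number a + ib *)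
Definition zscale (a b : R) x : Cn R n := a *: x + b *: mulI x.

Lemma dot_zscale a b x y : a ^+ 2 + b ^+ 2 = 1 ->
  dot (zscale a b x) (zscale a b y) = dot x y.
Proof.
move=> ab; rewrite /zscale !(dotDl, dotDr, dotZl, dotZr) dot_mulII.
by rewrite -[RHS]mul1r -ab !dot_mulI; ring.
Qed.

Lemma mulI_zscale a b x : mulI (zscale a b x) = zscale a b (mulI x).
Proof. by rewrite /zscale mulID !mulIZ. Qed.

Lemma zscaleA a b c d x :
  zscale a b (zscale c d x) = zscale (a * c - b * d) (a * d + b * c) x.
Proof.
rewrite /zscale mulID !mulIZ mulI_mulI; move: (mulI x) => y.
by apply/rowP => i; rewrite !mxE; ring.
Qed.

Lemma zscale10 x : zscale 1 0 x = x.
Proof. by rewrite /zscale scale1r scale0r addr0. Qed.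

Lemma rotation_subproof t (u : sphere R n) :
  dot (zscale (cos t) (sin t) (\val u)) (zscale (cos t) (sin t) (\val u)) == 1.
Proof. by rewrite dot_zscale ?sphereP// cos2Dsin2. Qed.

Definition rotation (t : R) (u : sphere R n) : sphere R n :=
  Sub (zscale (cos t) (sin t) (\val u)) (rotation_subproof t u).

Lemma rotationK t : cancel (rotation t) (rotation (- t)).
Proof.
move=> u; apply: val_inj; rewrite !SubK cosN sinN zscaleA.
rewrite mulNr opprK -!expr2 cos2Dsin2 mulNr mulrC subrr.
by rewrite zscale10.
Qed.

Lemma radial_ext_rotation t :
  radial_ext (\val \o rotation t) =
  (fun x => zscale (cos t) (sin t) (retraction x)).
Proof.
apply/funext => x; have [->|x0] := eqVneq x 0.
  (* At the origin [insub] fails and yields 0, which is also the value on the right; the equality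
     thus holds between functions. *)
  rewrite /radial_ext -/(retraction _).
  have r0 : retraction (0 : Cn R n) = 0 by rewrite /retraction scaler0.
  rewrite r0 insubF; last by rewrite dot0l eq_sym oner_eq0.
  have i0 : mulI (0 : Cn R n) = 0 by apply/eqP; rewrite mulI_eq0.
  by rewrite /zscale i0 !scaler0 addr0.
by have [u ux ->] := radial_extE x0; rewrite /= -ux.
Qed.

Lemma iter_derive_zscale (F : Cn R n -> Cn R n) a b s x :
  smooth_on punctured F -> x != 0 ->
  iter_derive s (fun x => zscale a b (F x)) x = zscale a b (iter_derive s F x).
Proof.
move=> sF; elim: s x => // v s IH x x0.
have d : is_derive x v (iter_derive s F) ('D_v (iter_derive s F) x).
  by apply: smooth_on_is_derive => //; exact: smooth_on_iter.
have dc : is_derive x v (fun y => zscale a b (iter_derive s F y))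
    (zscale a b ('D_v (iter_derive s F) x)).
  apply/is_derive_coordP => i.
  have h1 := (is_derive_coordP _ _ _ _).1 d i.
  have h2 := (is_derive_coordP _ _ _ _).1 (is_derive_mulI d) i.
  have h := is_derive_add (is_derive_mul (is_derive_cst a x v) h1)
    (is_derive_mul (is_derive_cst b x v) h2).
  apply: is_derive_fun h _ _ => [y|]; first by rewrite !mxE.
  by rewrite /= !mxE !mulr0 !addr0.
have : is_derive x v (iter_derive s (fun x => zscale a b (F x)))
    (zscale a b ('D_v (iter_derive s F) x)).
  by apply: is_derive_punctured x0 _ dc => y y0; rewrite IH.
by case.
Qed.

Lemma rotation_smooth t : smooth_map (rotation t).
Proof.
rewrite /smooth_map /smooth_sphere radial_ext_rotation.
have rr i : radial_class (fun x => retraction x 0 i).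
  rewrite (_ : (fun _ => _) = (fun x => (enorm x)^-1 * x 0 i)).
    by apply: radial_mul; [exact: radial_inv|exact: radial_coord].
  by apply/funext => x; rewrite mxE.
have ri i : radial_class (fun x => mulI (retraction x) 0 i).
  case: (split_ordP i) => j ->.
    rewrite (_ : (fun _ => _) = (fun x => -1 * retraction x 0 (rshift n j))).
      by apply: radial_mul; [exact: radial_cst|exact: rr].
    by apply/funext => x; rewrite /mulI row_mxEl !mxE mulN1r.
  rewrite (_ : (fun _ => _) = (fun x => retraction x 0 (lshift n j)))//.
  by apply/funext => x; rewrite /mulI row_mxEr !mxE.
apply: radial_on_smooth => i.
exists (fun x => cos t * retraction x 0 i + sin t * mulI (retraction x) 0 i).
  by apply: radial_add; apply: radial_mul; [exact: radial_cst|exact: rr|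
    exact: radial_cst|exact: ri].
move=> x _; rewrite /zscale; move: (retraction x) (mulI (retraction x)) => y z.
by rewrite !mxE.
Qed.

Lemma rotation_Diff t : Diff (rotation t).
Proof.
split; first exact: rotation_smooth.
exists (rotation (- t)); split; first exact: rotation_smooth.
  exact: rotationK.
by move=> u; have := rotationK (- t) u; rewrite opprK.
Qed.

Lemma derive_rotation t (u : sphere R n) v : dot (\val u) v = 0 ->
  'D_v (radial_ext (\val \o rotation t)) (\val u) = zscale (cos t) (sin t) v.
Proof.
move=> uv; rewrite radial_ext_rotation.
have := iter_derive_zscale (cos t) (sin t) [:: v] (@retraction_smooth R n)
  (sphere_neq0 u).
by rewrite /iter_derive /= derive_retraction.
Qed.

Lemma smooth_sphere_cst (V : normedModType R) (c : V) :
  smooth_sphere (fun _ : sphere R n => c).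
Proof.
move=> s x x0.
have [d dE] : exists d, forall y : Cn R n, y != 0 ->
    iter_derive s (radial_ext (fun=> c)) y = d.
  elim: s => [|v s [d IH]].
    by exists c => y y0; have [u _ E] := radial_extE y0; exact: E.
  exists 0 => y y0.
  have : is_derive y v (iter_derive s (radial_ext (fun=> c))) 0.
    apply: (is_derive_punctured (F := cst d)) y0 _ (is_derive_cst d y v).
    by move=> z z0; rewrite IH.
  by case.
apply: near_eq_differentiable (differentiable_cst d x).
by apply: filterS (near_punctured x0) => y y0; rewrite dE.
Qed.

Lemma rotation_Conf (rho t : R) : Conf (g_rho rho) (rotation t).
Proof.
split; first exact: rotation_Diff.
exists (fun=> 1); split=> //; first exact: smooth_sphere_cst.
move=> u v w uv uw; rewrite mul1r /pullback /sphere_diff !derive_rotation//.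
have vr : \val (rotation t u) = zscale (cos t) (sin t) (\val u) by rewrite SubK.
by rewrite /g_rho /Defs.eta /Defs.xi /g_st vr mulI_zscale !dot_zscale ?cos2Dsin2.
Qed.

Lemma rotation0 : rotation 0 = id.
Proof.
by apply/funext => u; apply: val_inj; rewrite SubK cos0 sin0 zscale10.
Qed.

Lemma rotation2pi (m : nat) : rotation (m%:R * (pi *+ 2)) = id.
Proof.
apply/funext => u; apply: val_inj; rewrite SubK.
have [-> ->] : cos (m%:R * (pi *+ 2)) = 1 :> R /\ sin (m%:R * (pi *+ 2)) = 0 :> R.
  elim: m => [|m [c s]]; first by rewrite mul0r cos0 sin0.
  by rewrite -natr1 mulrDl mul1r cosD2pi sinD2pi c s.
by rewrite zscale10.
Qed.

Lemma sphere_iter_derive_rotation t s (u : sphere R n) :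
  sphere_iter_derive (\val \o rotation t) s u =
  zscale (cos t) (sin t) (iter_derive s (@retraction R n) (\val u)).
Proof.
rewrite /sphere_iter_derive radial_ext_rotation iter_derive_zscale//.
  exact: retraction_smooth.
exact: sphere_neq0.
Qed.

Lemma norm_mulI_le x : `|mulI x| <= `|x|.
Proof.
have H j : `|x 0 j| <= `|x|.
  by rewrite [leRHS]/Num.Def.normr /= mx_normrE; exact: (le_bigmax _ _ (0, j)).
rewrite [leLHS]/Num.Def.normr /= mx_normrE; apply: bigmax_le => // -[i j] _ /=.
rewrite (ord1 i) /mulI; case: (split_ordP j) => k ->.
  by rewrite row_mxEl !mxE normrN.
by rewrite row_mxEr !mxE.
Qed.

Lemma sphere_bounded (F : Cn R n -> Cn R n) : smooth_on punctured F ->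
  exists M, forall u : sphere R n, `|F (\val u)| <= M.
Proof.
move=> sF; pose A := [set x : Cn R n | dot x x = 1].
(* For n = 0 the sphere is empty and has no maximum point, but any bound will do. *)
have [[u _]|noS] := pselect (exists u : sphere R n, True); last first.
  by exists 0 => u; case: noS; exists u.
have cdot : continuous (fun x : Cn R n => dot x x).
  by move=> x; exact: differentiable_continuous (differentiable_dot x).
have cA : compact A.
  apply: bounded_closed_compact.
    exists 1; split; first exact: num_real.
    move=> e e1 x /= x1; apply: le_trans (ltW e1).
    rewrite /Num.Def.normr /= mx_normrE; apply: bigmax_le => // -[i j] _ /=.
    rewrite (ord1 i) -(@expr_le1 _ 2)// real_normK ?num_real// -x1.
    rewrite /dot (bigD1 j)//= -expr2 lerDl.
    by apply: sumr_ge0 => k _; rewrite -expr2 sqr_ge0.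
  rewrite (_ : A = (fun x : Cn R n => dot x x) @^-1` [set 1]) //.
  apply: closed_comp; first by move=> x _; exact: cdot.
  exact: accessible_closed_set1 (hausdorff_accessible (@norm_hausdorff _ _)) _.
have cF : {within A, continuous (fun x => `|F x|)}.
  apply: continuous_in_subspaceT => x; rewrite inE /A /= => x1.
  have x0 : x != 0.
    by apply/eqP => x0; move: x1; rewrite x0 dot0l => /esym/eqP; rewrite oner_eq0.
  apply: (@continuous_comp _ _ _ F (fun y : Cn R n => `|y|)).
    by apply: differentiable_continuous; exact: smooth_on_differentiable.
  exact: norm_continuous.
have [c _ cmax] := EVT_max_rV (ex_intro _ (\val u) (sphereP u)) cA cF.
exists `|F c| => w; apply: cmax; rewrite inE; exact: sphereP.
Qed.

(** Every iterated derivative of a rotation is cos t + i sin t times a fixed function bounded on the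
    sphere, so the uniform estimates reduce to continuity of cos and sin. *)
Lemma rotation_continuous (c : R) :
  continuous (fun t => rotation (c * t) : @sphere_map R n).
Proof.
apply: continuous_sphere_map => s t e e0.
have [M HM] := sphere_bounded (smooth_on_iter s (@retraction_smooth R n)).
have M0 : 0 <= `|M| + `|M| by rewrite addr_ge0.
have B (u : sphere R n) : `|iter_derive s (@retraction R n) (\val u)| <= `|M|.
  exact: le_trans (HM u) (ler_norm M).
pose d := e / (`|M| + `|M| + 1).
have d0 : 0 < d by rewrite divr_gt0// ltr_wpDl.
have cs : \forall t' \near t, `|cos (c * t) - cos (c * t')| < d.
  have k : continuous (fun t => cos (c * t)).
    by move=> x; apply: continuous_comp; [exact: mulrl_continuous|exact: continuous_cos].
  by have /cvgrPdist_lt /(_ d d0) := k t.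
have sn : \forall t' \near t, `|sin (c * t) - sin (c * t')| < d.
  have k : continuous (fun t => sin (c * t)).
    by move=> x; apply: continuous_comp; [exact: mulrl_continuous|exact: continuous_sin].
  by have /cvgrPdist_lt /(_ d d0) := k t.
apply: filterS2 cs sn => t' ct st u.
rewrite !sphere_iter_derive_rotation.
move: (iter_derive s _ _) (B u) => y By.
have -> : zscale (cos (c * t)) (sin (c * t)) y - zscale (cos (c * t')) (sin (c * t')) y
  = (cos (c * t) - cos (c * t')) *: y + (sin (c * t) - sin (c * t')) *: mulI y.
  by rewrite /zscale !scalerBl opprD addrACA.
apply: (le_lt_trans (ler_normD _ _)); rewrite !normrZ.
apply: (@le_lt_trans _ _ (d * `|M| + d * `|M|)).
  apply: lerD; apply: ler_pM => //; try exact: ltW.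
  exact: le_trans (norm_mulI_le y) By.
rewrite -mulrDr /d mulrAC ltr_pdivrMr ?ltr_wpDl// ltr_pM2l//.
by rewrite ltrDl.
Qed.

End Rotation.

(** * Winding numbers *)

Section Winding.
Context {R : realType}.
Implicit Types z w u : R * R.

(** With a = atan p and b = atan q, cos (a + b) = cos a cos b (1 - p q) > 0. This confines a + b to
    the interval on which atan inverts tan. *)
Lemma atanD (p q : R) : 0 < 1 - p * q ->
  atan p + atan q = atan ((p + q) / (1 - p * q)).
Proof.
move=> pq; set a := atan p; set b := atan q.
have ca : 0 < cos a by rewrite cos_gt0_pihalf// atan_gtNpi2 atan_ltpi2.
have cb : 0 < cos b by rewrite cos_gt0_pihalf// atan_gtNpi2 atan_ltpi2.
have Da : cos a != 0 by rewrite gt_eqF.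
have Db : cos b != 0 by rewrite gt_eqF.
have sa : sin a = p * cos a by rewrite -[in RHS](atanK p) /tan -/a divfK.
have sb : sin b = q * cos b by rewrite -[in RHS](atanK q) /tan -/b divfK.
have cab : 0 < cos (a + b).
  rewrite cosD sa sb (_ : _ - _ = cos a * cos b * (1 - p * q)); last by ring.
  by rewrite !mulr_gt0.
have a1 := atan_gtNpi2 p; have a2 := atan_ltpi2 p.
have b1 := atan_gtNpi2 q; have b2 := atan_ltpi2 q.
have upper c : c < pi -> 0 < cos c -> c < pi / 2.
  move=> cpi; rewrite ltNge => cc; rewrite ltNge; apply: contra cc => cpi2.
  rewrite -(subrK (pi / 2) c) cosDpihalf oppr_le0; apply: sin_ge0_pi.
  by rewrite subr_ge0 cpi2 /= lerBlDr; have := pi_gt0 R => h; lra.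
have ab : a + b \in `](- (pi / 2)), (pi / 2)[.
  rewrite in_itv /= upper//; last by rewrite /a /b; lra.
  rewrite andbT ltrNl; apply: upper; first by rewrite /a /b; lra.
  by rewrite cosN.
rewrite -[LHS](tanK ab) tanD// !atanK; congr atan.
Qed.

(** [rdot] and [rcross] are the real and imaginary parts of conj(z) w. *)
Definition rdot z w : R := z.1 * w.1 + z.2 * w.2.
Definition rcross z w : R := z.1 * w.2 - z.2 * w.1.
(* the oriented angle from z to w, meaningful only when rdot z w > 0 *)
Definition angle z w : R := atan (rcross z w / rdot z w).

(** [e1] and [e2] are the two parts of conj(z) w conj(w) u = |w|^2 conj(z) u; the addition formula
    for atan does the rest. *)
Lemma angleD z w u : 0 < rdot z w -> 0 < rdot w u -> 0 < rdot z u ->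
  angle z w + angle w u = angle z u.
Proof.
move=> zw wu zu; rewrite /angle.
have ww : 0 < rdot w w.
  rewrite lt_neqAle eq_sym paddr_eq0 -?expr2 ?sqr_ge0// !sqrf_eq0.
  rewrite /rdot -!expr2 addr_ge0 ?sqr_ge0// andbT.
  apply/negP => /andP[/eqP w1 /eqP w2].
  by move: zw; rewrite /rdot w1 w2 !mulr0 addr0 ltxx.
have e1 : rdot z u * rdot w w = rdot z w * rdot w u - rcross z w * rcross w u.
  by rewrite /rdot /rcross; ring.
have e2 : rcross z u * rdot w w = rcross z w * rdot w u + rdot z w * rcross w u.
  by rewrite /rdot /rcross; ring.
move: (rdot z w) (rdot w u) (rdot z u) (rdot w w) (rcross z w) (rcross w u)
  (rcross z u) zw wu zu ww e1 e2 => a b c d x y t a0 b0 c0 d0 e1 e2.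
have E : 1 - x / a * (y / b) = c * d / (a * b).
  by rewrite e1; field; rewrite !gt_eqF.
rewrite atanD E ?divr_gt0 ?mulr_gt0//; congr atan.
have -> : x / a + y / b = t * d / (a * b) by rewrite e2; field; rewrite !gt_eqF.
by field; rewrite !gt_eqF.
Qed.

(** The diagonal cuts each grid square into two triangles to which [angleD] applies. The edges
    joining rows j and j+1 then telescope in k and cancel by periodicity. *)
Lemma grid_winding (N : nat) (z : nat -> nat -> R * R) :
  (forall j k, (j < N)%N -> (k < N)%N ->
    [/\ 0 < rdot (z j k) (z j k.+1), 0 < rdot (z j k.+1) (z j.+1 k.+1),
        0 < rdot (z j k) (z j.+1 k.+1), 0 < rdot (z j k) (z j.+1 k) &
        0 < rdot (z j.+1 k) (z j.+1 k.+1)]) ->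
  (forall j, (j <= N)%N -> z j 0 = z j N) ->
  \sum_(k < N) angle (z 0 k) (z 0 k.+1) = \sum_(k < N) angle (z N k) (z N k.+1).
Proof.
move=> H per.
suff S j : (j <= N)%N -> \sum_(k < N) angle (z 0 k) (z 0 k.+1) =
    \sum_(k < N) angle (z j k) (z j k.+1) by exact: S.
elim: j => // j IH jN; rewrite IH ?(ltnW jN)//.
apply/eqP; rewrite -subr_eq0 -sumrB.
have -> : \sum_(k < N) (angle (z j k) (z j k.+1) - angle (z j.+1 k) (z j.+1 k.+1))
  = \sum_(k < N) (angle (z j k) (z j.+1 k) - angle (z j k.+1) (z j.+1 k.+1)).
  apply: eq_bigr => k _; have [h1 h2 h3 h4 h5] := H j k jN (ltn_ord k).
  by have := angleD h1 h2 h3; have := angleD h4 h5 h3 => e1 e2; lra.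
rewrite -(big_mkord xpredT
  (fun k => angle (z j k) (z j.+1 k) - angle (z j k.+1) (z j.+1 k.+1))).
under eq_bigr do rewrite -opprB.
rewrite sumrN telescope_sumr// -!per ?subrr ?oppr0//.
exact: ltnW.
Qed.

Definition circle (t : R) : R * R := (cos t, sin t).

Lemma angle_circle (t d : R) : 0 <= d < pi / 2 ->
  0 < rdot (circle t) (circle (t + d)) /\ angle (circle t) (circle (t + d)) = d.
Proof.
move=> /andP[d0 d1].
have -> : rdot (circle t) (circle (t + d)) = cos d.
  by rewrite /rdot /= -cosB opprD addNKr cosN.
rewrite cos_gt0_pihalf; last by rewrite d1 andbT; have := pi_gt0 R => h; lra.
split=> //; rewrite /angle.
have -> : rdot (circle t) (circle (t + d)) = cos d.
  by rewrite /rdot /= -cosB opprD addNKr cosN.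
have -> : rcross (circle t) (circle (t + d)) = sin d.
  have -> : sin d = sin (t + d - t) by congr sin; ring.
  by rewrite sinB /rcross /=; ring.
apply: tanK; rewrite in_itv /= d1 andbT; have := pi_gt0 R => h; lra.
Qed.

(** The condition 4m < N keeps each step 2 pi m / N below pi/2, where the oriented angle recovers
    the step exactly. *)
Lemma circle_winding (m N : nat) : (4 * m < N)%N ->
  let t := m%:R * (pi *+ 2) / N%:R in
  \sum_(k < N) angle (circle (k%:R * t)) (circle (k.+1%:R * t))
  = m%:R * (pi *+ 2).
Proof.
move=> mN t; have N0 : (0 : R) < N%:R by rewrite ltr0n; lia.
have pi0 := pi_gt0 R.
have t0 : 0 <= t < pi / 2.
  have h : (4 * m)%:R < N%:R :> R by rewrite ltr_nat.
  have e : m%:R * (pi *+ 2) = pi / 2 * (4 * m)%:R :> R by rewrite natrM; field.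
  rewrite /t e divr_ge0 ?mulr_ge0 ?divr_ge0 ?ler0n ?(ltW pi0)//=.
  by rewrite ltr_pdivrMr// ltr_pM2l// divr_gt0.
transitivity (\sum_(k < N) t).
  apply: eq_bigr => k _; rewrite -natr1 mulrDl mul1r.
  by have [] := angle_circle (k%:R * t) t0.
by rewrite sumr_const card_ord -[t *+ N]mulr_natr /t divfK// gt_eqF.
Qed.

Definition clamp (t : R) : R := Num.max 0 (Num.min 1 t).

Lemma clamp_itv t : 0 <= clamp t <= 1.
Proof. by rewrite /clamp le_max lexx /= ge_max ler01 /= ge_min lexx. Qed.

Lemma clamp_id t : 0 <= t <= 1 -> clamp t = t.
Proof. by move=> /andP[t0 t1]; rewrite /clamp (min_idPr t1) (max_idPr t0). Qed.

Lemma clamp_continuous : continuous clamp.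
Proof.
move=> t; apply: (@continuous_max R R (cst 0) (fun t => Num.min 1 t)).
  exact: cst_continuous.
by apply: (@continuous_min R R (cst 1) id); [exact: cst_continuous|].
Qed.

(** The first coordinate is the homotopy parameter. On a fine grid neighbouring values form acute
    angles, so [grid_winding] equates the angle sums of the two extreme rows, which [circle_winding]
    evaluates. *)
Lemma winding_homotopy (x y : R * R -> R) (a b : nat) :
  continuous x -> continuous y ->
  (forall p, 0 < x p ^+ 2 + y p ^+ 2) ->
  (forall s, x (s, 0) = x (s, 1) /\ y (s, 0) = y (s, 1)) ->
  (forall t, 0 <= t <= 1 -> x (0, t) = cos (t * (a%:R * (pi *+ 2))) /\
     y (0, t) = sin (t * (a%:R * (pi *+ 2)))) ->
  (forall t, 0 <= t <= 1 -> x (1, t) = cos (t * (b%:R * (pi *+ 2))) /\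
     y (1, t) = sin (t * (b%:R * (pi *+ 2)))) ->
  a = b.
Proof.
move=> cx cy pos per H0 H1.
pose Z p : R * R := (x p, y p).
pose K : set (R * R) := `[0, 1]%classic `*` `[0, 1]%classic.
have cK : compact K by apply: compact_setX; exact: segment_compact.
(* A Lebesgue number for the square: [rdot (Z p) (Z p)] is positive, hence [rdot] is positive near
   (p, p), and compactness makes the radius uniform. *)
have unif : \forall d \near (0 : R)^'+, K `<=` [set p | forall q,
    `|p.1 - q.1| < d -> `|p.2 - q.2| < d -> 0 < rdot (Z p) (Z q)].
  move/compact_near_coveringP : cK; apply => p _.
  have : \forall pq \near (p, p), 0 < rdot (Z pq.1) (Z pq.2).
    have c1 (h : R * R -> R) : continuous h ->
        h pq.1 @[pq --> (p, p)] --> h p.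
      by move=> ch; apply: (cvg_comp (fun pq : (R * R) * (R * R) => pq.1) h);
        [exact: cvg_fst|exact: ch].
    have c2 (h : R * R -> R) : continuous h ->
        h pq.2 @[pq --> (p, p)] --> h p.
      by move=> ch; apply: (cvg_comp (fun pq : (R * R) * (R * R) => pq.2) h);
        [exact: cvg_snd|exact: ch].
    have c : rdot (Z pq.1) (Z pq.2) @[pq --> (p, p)] --> rdot (Z p) (Z p).
      by apply: cvgD; apply: cvgM; [exact: c1|exact: c2|exact: c1|exact: c2].
    by move/cvgr_gt : c; apply; rewrite /rdot -!expr2 /=; exact: pos.
  move=> /nbhs_ballP[r /= r0 Hr]; have r20 : 0 < r / 2 by rewrite divr_gt0.
  exists (ball p (r / 2), [set i | i < r / 2]) => /=.
    by split; [exact: nbhsx_ballx|exact: nbhs_right_lt].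
  move=> [p' i] /= [[b1 b2] ir] q q1 q2.
  have tri (u v w : R) : ball u (r / 2) v -> `|v - w| < i -> ball u r w.
    rewrite -ball_normE /= => uv vw; rewrite -(subrKA v).
    by apply: (le_lt_trans (ler_normD _ _)); lra.
  apply: (Hr (p', q)); split=> /=; split.
  - by apply: le_ball b1; lra.
  - by apply: le_ball b2; lra.
  - exact: tri b1 q1.
  - exact: tri b2 q2.
have [d [d0 Hd]] : exists d : R, 0 < d /\ K `<=` [set p | forall q,
    `|p.1 - q.1| < d -> `|p.2 - q.2| < d -> 0 < rdot (Z p) (Z q)].
  exact: filter_ex (filterI (nbhs_right_gt 0) unif).
(* The first two bounds are for [circle_winding]; the last makes all grid edges, diagonals included,
   shorter than d in each coordinate. *)
have [N [aN bN N0 Nd]] : exists N : nat,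
    [/\ (4 * a < N)%N, (4 * b < N)%N, (0 : R) < N%:R & N%:R^-1 < d].
  pose N := (4 * a + 4 * b + Num.bound d^-1).+1; exists N.
  split; rewrite ?ltr0n// /N; [by lia|by lia|].
  rewrite -[ltRHS]invrK ltf_pV2 ?posrE ?invr_gt0 ?ltr0n//.
  apply: (lt_le_trans (archi_boundP _)); first by rewrite invr_ge0 ltW.
  by rewrite ler_nat; lia.
have step (j : nat) : j%:R / N%:R - j.+1%:R / N%:R = - N%:R^-1 :> R.
  by rewrite -natr1; field; rewrite gt_eqF.
have dN : `|- N%:R^-1 : R| < d by rewrite normrN gtr0_norm// invr_gt0.
have in01 (j : nat) : (j <= N)%N -> 0 <= (j%:R / N%:R : R) <= 1.
  move=> jN; apply/andP; split; first by rewrite divr_ge0 ?ler0n.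
  by rewrite ler_pdivrMr// mul1r ler_nat.
pose z j k := Z (j%:R / N%:R, k%:R / N%:R).
have := @grid_winding N z.
have zz j k q : (j <= N)%N -> (k <= N)%N -> `|j%:R / N%:R - q.1| < d ->
    `|k%:R / N%:R - q.2| < d -> 0 < rdot (z j k) (Z q).
  by move=> jN kN q1 q2; apply: Hd => //; split; exact: in01.
have same (c : R) : `|c - c| < d by rewrite subrr normr0.
have -> : \sum_(k < N) angle (z 0 k) (z 0 k.+1) = a%:R * (pi *+ 2).
  rewrite -(circle_winding aN).
  apply: eq_bigr => k _; congr angle; rewrite /z /Z /circle mul0r.
    have [-> ->] := H0 _ (in01 k (ltnW (ltn_ord k))).
    by rewrite mulrAC mulrA (mulrAC k%:R).
  have [-> ->] := H0 _ (in01 k.+1 (ltn_ord k)).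
  by rewrite mulrAC mulrA (mulrAC k.+1%:R).
have -> : \sum_(k < N) angle (z N k) (z N k.+1) = b%:R * (pi *+ 2).
  rewrite -(circle_winding bN).
  apply: eq_bigr => k _; congr angle; rewrite /z /Z /circle divff ?gt_eqF//.
    have [-> ->] := H1 _ (in01 k (ltnW (ltn_ord k))).
    by rewrite mulrAC mulrA (mulrAC k%:R).
  have [-> ->] := H1 _ (in01 k.+1 (ltn_ord k)).
  by rewrite mulrAC mulrA (mulrAC k.+1%:R).
have pi20 : (pi : R) *+ 2 != 0 by rewrite mulrn_eq0 /= gt_eqF// pi_gt0.
move=> W; have : a%:R * (pi *+ 2) = b%:R * (pi *+ 2) :> R.
  apply: W => [j k jN kN|j jN].
    split; apply: zz; rewrite ?step//; exact: ltnW.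
  by rewrite /z /Z mul0r divff ?gt_eqF//; have [-> ->] := per (j%:R / N%:R).
by move=> /(mulIf pi20)/eqP; rewrite eqr_nat => /eqP.
Qed.

End Winding.

(** * The determinant of the unitary frame *)

From mathcomp Require Import complex.

Section ComplexContinuity.
Context {R : realType} {T : topologicalType}.

Definition ccontinuous (f : T -> R[i]) :=
  continuous (fun x => complex.Re (f x)) /\ continuous (fun x => complex.Im (f x)).

Lemma ccontinuous_add f g : ccontinuous f -> ccontinuous g ->
  ccontinuous (fun x => f x + g x).
Proof.
move=> [f1 f2] [g1 g2]; split=> x.
  rewrite (_ : (fun x => complex.Re (f x + g x))
    = (fun x => complex.Re (f x) + complex.Re (g x))).
    by apply: cvgD; [exact: f1|exact: g1].
  by apply/funext => y; case: (f y) (g y) => ? ? [? ?].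
rewrite (_ : (fun x => complex.Im (f x + g x))
  = (fun x => complex.Im (f x) + complex.Im (g x))).
  by apply: cvgD; [exact: f2|exact: g2].
by apply/funext => y; case: (f y) (g y) => ? ? [? ?].
Qed.

Lemma ccontinuous_mul f g : ccontinuous f -> ccontinuous g ->
  ccontinuous (fun x => f x * g x).
Proof.
move=> [f1 f2] [g1 g2]; split=> x.
  rewrite (_ : (fun x => complex.Re (f x * g x))
    = (fun x => complex.Re (f x) * complex.Re (g x)
              - complex.Im (f x) * complex.Im (g x))).
    by apply: cvgB; apply: cvgM; [exact: f1|exact: g1|exact: f2|exact: g2].
  by apply/funext => y; case: (f y) (g y) => ? ? [? ?].
rewrite (_ : (fun x => complex.Im (f x * g x))
  = (fun x => complex.Re (f x) * complex.Im (g x)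
            + complex.Im (f x) * complex.Re (g x))).
  by apply: cvgD; apply: cvgM; [exact: f1|exact: g2|exact: f2|exact: g1].
by apply/funext => y; case: (f y) (g y) => ? ? [? ?].
Qed.

Lemma ccontinuous_cst c : ccontinuous (fun=> c).
Proof. by split=> x; exact: cst_continuous. Qed.

Lemma ccontinuous_det n (M : T -> 'M[R[i]]_n) :
  (forall i j, ccontinuous (fun x => M x i j)) ->
  ccontinuous (fun x => \det (M x)).
Proof.
move=> h.
have big (op : R[i] -> R[i] -> R[i]) idx I (s : seq I) (f : I -> T -> R[i]) :
    (forall g g', ccontinuous g -> ccontinuous g' ->
      ccontinuous (fun x => op (g x) (g' x))) ->
    (forall i, ccontinuous (f i)) ->
    ccontinuous (fun x => \big[op/idx]_(i <- s) f i x).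
  move=> hop hf; elim: s => [|i s IH].
    rewrite (_ : (fun _ => _) = (fun=> idx)); first exact: ccontinuous_cst.
    by apply/funext => x; rewrite big_nil.
  rewrite (_ : (fun _ => _) = (fun x => op (f i x) (\big[op/idx]_(i <- s) f i x))).
    exact: hop.
  by apply/funext => x; rewrite big_cons.
apply: (@big _) => [|s]; first exact: ccontinuous_add.
apply: ccontinuous_mul; first exact: ccontinuous_cst.
by apply: (@big _) => [|i]; first exact: ccontinuous_mul.
Qed.

End ComplexContinuity.

Section Frame.
Context {R : realType} {n : nat}.

Definition toC (v : Cn R n) (j : 'I_n) : R[i] :=
  (v 0 (lshift n j) +i* v 0 (rshift n j))%C.

Lemma hermitian_dot (u v : Cn R n) :
  \sum_j toC u j * (toC v j)^*%C = (dot u v +i* - dot (mulI u) v)%C.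
Proof.
have sumC (f g : 'I_n -> R) : \sum_j (f j +i* g j)%C = ((\sum_j f j) +i* (\sum_j g j))%C.
  by elim: (index_enum _) => [|j s IH]; rewrite ?big_nil// !big_cons IH.
rewrite /dot !big_split_ord /=.
rewrite (eq_bigr (fun j => ((u 0 (lshift n j) * v 0 (lshift n j)
    + u 0 (rshift n j) * v 0 (rshift n j))
  +i* (u 0 (rshift n j) * v 0 (lshift n j)
    - u 0 (lshift n j) * v 0 (rshift n j)))%C)); last first.
  by move=> j _; apply/eqP; rewrite eq_complex /=; apply/andP; split; apply/eqP; ring.
rewrite sumC; congr (_ +i* _)%C; first by rewrite big_split.
rewrite opprD -!sumrN -big_split /=; apply: eq_bigr => j _.
by rewrite /mulI row_mxEl row_mxEr !mxE; ring.
Qed.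

Lemma toC_zscale a b (v : Cn R n) j :
  toC (zscale a b v) j = (a +i* b)%C * toC v j.
Proof.
have l : mulI v 0 (lshift n j) = - v 0 (rshift n j) by rewrite /mulI row_mxEl !mxE.
have r : mulI v 0 (rshift n j) = v 0 (lshift n j) by rewrite /mulI row_mxEr !mxE.
rewrite /toC /zscale; move: (mulI v) l r => w l r.
rewrite !mxE l r; apply/eqP; rewrite eq_complex /=.
by apply/andP; split; apply/eqP; ring.
Qed.

Definition std_basis (k : 'I_n) : Cn R n := row_mx (delta_mx 0 k) 0.

Lemma std_basis_orthogonal k l : k != l ->
  dot (std_basis k) (std_basis l) = 0 /\ dot (mulI (std_basis k)) (std_basis l) = 0.
Proof.
move=> kl; split.
  rewrite dot_row trmx0 mulmx0 addr0 trmx_delta mul_delta_mx_0// mxE//.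
rewrite /mulI row_mxKl row_mxKr dot_row trmx0 mulmx0 addr0 oppr0 mul0mx mxE//.
Qed.

Lemma std_basis_unit k : dot (std_basis k) (std_basis k) = 1.
Proof.
by rewrite dot_row trmx0 mulmx0 addr0 trmx_delta mul_delta_mx mxE !eqxx.
Qed.

Lemma std_basis_neq0 k : std_basis k != 0.
Proof. by rewrite -dot_eq0 std_basis_unit oner_eq0. Qed.

Lemma toC_std_basis k j : toC (std_basis k) j = (k == j)%:R.
Proof.
rewrite /toC /std_basis row_mxEl row_mxEr !mxE eqxx /= eq_sym.
by case: eqP.
Qed.

(** The Gram matrix of the rows is diagonal with nonzero entries |c k|^2. *)
Lemma det_neq0_hermitian (c : 'I_n -> Cn R n) :
  (forall k, c k != 0) ->
  (forall k l, k != l -> dot (c k) (c l) = 0 /\ dot (mulI (c k)) (c l) = 0) ->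
  \det (\matrix_(k, j) toC (c k) j) != 0.
Proof.
move=> c0 orth; set M := \matrix_(k, j) _.
have : \det (M *m (map_mx (@conjc R) M)^T) != 0.
  rewrite (_ : _ *m _ = diag_mx (\row_k (dot (c k) (c k))%:C%C)).
    rewrite det_diag; apply/prodf_neq0 => k _; rewrite mxE eq_complex /=.
    by rewrite eqxx andbT dot_eq0.
  apply/matrixP => k l; rewrite !mxE.
  under eq_bigr do rewrite !mxE.
  rewrite hermitian_dot; have [<-|kl] := eqVneq k l.
    by rewrite dot_mulI_self oppr0 mulr1n.
  by have [-> ->] := orth k l kl; rewrite oppr0 mulr0n.
by rewrite det_mulmx mulf_eq0 negb_or => /andP[].
Qed.

End Frame.

Section FrameDeterminant.
Context {R : realType} {n : nat}.
Local Notation N := n.+1.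

Definition base_point : sphere R N :=
  Sub (std_basis ord0) (introT eqP (std_basis_unit (ord0 : 'I_N))).

(* the image of the standard basis (e_0, e_1, ...) at p = e_0, where e_0 is sent to
   psi(p) and the other vectors, which span D_p, by the differential of psi at p *)
Definition frame (psi : @sphere_map R N) (k : 'I_N) : Cn R N :=
  sphere_iter_derive (\val \o psi) (if k == ord0 then [::] else [:: std_basis k])
    base_point.

Definition frame_det (psi : @sphere_map R N) : R[i] :=
  \det (\matrix_(k, j) toC (frame psi k) j).

(** The entries are coordinates of derivatives of order 0 or 1 at one point, which depend
    continuously on psi for the C^oo topology. *)
Lemma frame_det_continuous : ccontinuous frame_det.
Proof.
apply: ccontinuous_det => k j.
have c l : continuous (fun psi : @sphere_map R N => frame psi k 0 l : R).
  move=> psi; apply: (@continuous_comp _ _ _ (fun psi => frame psi k)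
    (fun v : 'rV[R]_(N + N) => v 0 l)).
    exact: sphere_map_eval_continuous.
  exact: coord_continuous.
split.
  rewrite (_ : (fun _ => _) = (fun psi => frame psi k 0 (lshift N j)))//.
  by apply/funext => psi; rewrite mxE.
rewrite (_ : (fun _ => _) = (fun psi => frame psi k 0 (rshift N j)))//.
by apply/funext => psi; rewrite mxE.
Qed.

Lemma contact_std_basis k : k != ord0 -> contact (\val base_point) (std_basis k).
Proof.
by rewrite eq_sym => /(@std_basis_orthogonal R).
Qed.

Lemma frame_det_neq0 (rho : R) (psi : @sphere_map R N) :
  (2 < N)%N -> rho != 0 -> Conf (g_rho rho) psi -> frame_det psi != 0.
Proof.
move=> N2 rho0 [[spsi [phi [sphi psiK phiK]]] [f [sf f0 conf]]].
have p0 := sphere_neq0 base_point.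
pose F := radial_ext (\val \o psi : sphere R N -> Cn R N).
have frame0 k : k = ord0 -> frame psi k = F (\val base_point).
  by move=> ->.
have frameS k : k != ord0 -> frame psi k = 'D_(std_basis k) F (\val base_point).
  by move=> /negPf k0; rewrite /frame k0.
have F1 := dot_radial_ext psi p0.
have FE k : k != ord0 -> dot (F (\val base_point)) (frame psi k) = 0 /\
    dot (mulI (F (\val base_point))) (frame psi k) = 0.
  move=> k0; rewrite frameS//; split.
    apply: (dot_F_E (F := F) (E := fun v => 'D_v F)); last exact: p0.
      by move=> x v x0; exact: smooth_on_is_derive.
    by move=> x; exact: dot_radial_ext.
  exact: (conf_contact_sphere spsi sphi phiK psiK sf f0 conf N2 rho0
    (contact_std_basis k0)).
apply: det_neq0_hermitian => [k|k l].
  have [k0|k0] := eqVneq k ord0.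
    by rewrite frame0// -dot_eq0 F1 oner_eq0.
  rewrite frameS//.
  exact: (conf_derive_neq0 spsi sphi phiK psiK sf f0 conf N2 rho0
    (contact_std_basis k0) (std_basis_neq0 k)).
have [k0|k0] := eqVneq k ord0; have [l0|l0] := eqVneq l ord0.
- by rewrite k0 l0 eqxx.
- by move=> _; rewrite (frame0 k k0); exact: FE.
- move=> _; rewrite (frame0 l l0); have [h1 h2] := FE k k0.
  by split; [rewrite dotC|rewrite dot_mulIC h2 oppr0].
- move=> kl; have [e1 e2] := @std_basis_orthogonal R _ _ _ kl; rewrite !frameS//.
  exact: (conf_hermitian spsi sphi phiK psiK sf f0 conf N2 rho0
    (contact_std_basis k0) (contact_std_basis l0) e1 e2).
Qed.

Lemma de_moivre (t : R) m :
  ((cos t +i* sin t) ^+ m = cos (m%:R * t) +i* sin (m%:R * t))%C.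
Proof.
elim: m => [|m IH]; first by rewrite mul0r cos0 sin0 expr0.
rewrite exprS IH -natr1 mulrDl mul1r addrC cosD sinD.
by apply/eqP; rewrite eq_complex /=; apply/andP; split; apply/eqP; ring.
Qed.

Lemma frame_det_rotation (t : R) :
  frame_det (rotation t) = (cos (N%:R * t) +i* sin (N%:R * t))%C.
Proof.
have rot k : frame (rotation t) k = zscale (cos t) (sin t) (std_basis k).
  rewrite /frame sphere_iter_derive_rotation; congr zscale.
  have [->|k0] := eqVneq k ord0; first exact: retraction_id (std_basis_unit _).
  exact: derive_retraction (proj1 (contact_std_basis k0)).
rewrite /frame_det -de_moivre -det_scalar; congr (\det _).
by apply/matrixP => k j; rewrite !mxE rot toC_zscale toC_std_basis mulr_natr.
Qed.

(** * Powers of the Hopf loop *)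

Definition rotation_loop (m : nat) (t : R) : @sphere_map R N :=
  rotation (m%:R * (pi *+ 2) * t).

Lemma rotation_loopP (rho : R) m :
  loops (Conf (g_rho rho)) id (rotation_loop m).
Proof.
split.
- by apply: continuous_subspaceT; exact: rotation_continuous.
- by move=> t _; exact: rotation_Conf.
- by rewrite /rotation_loop mulr0 rotation0.
- by rewrite /rotation_loop mulr1 rotation2pi.
Qed.

(** A homotopy is continuous only within the square; composing with the retraction of the plane onto
    it gives the global continuity that [winding_homotopy] asks for. *)
Lemma continuous_clamp (T : topologicalType) (H : R * R -> T) :
  {within I01 `*` I01, continuous H} ->
  continuous (fun p => H (clamp p.1, clamp p.2)).
Proof.
move=> /subspace_continuousP cH p.
have Kp : (I01 `*` I01 : set (R * R)) (clamp p.1, clamp p.2).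
  by split; exact: clamp_itv.
have cl1 : clamp q.1 @[q --> p] --> clamp p.1.
  by apply: (cvg_comp fst clamp); [exact: cvg_fst|exact: clamp_continuous].
have cl2 : clamp q.2 @[q --> p] --> clamp p.2.
  by apply: (cvg_comp snd clamp); [exact: cvg_snd|exact: clamp_continuous].
have cc := cvg_pair cl1 cl2.
have cw : (clamp q.1, clamp q.2) @[q --> p] -->
    within (I01 `*` I01) (nbhs (clamp p.1, clamp p.2)).
  move=> P hP; have k : \forall q \near p, (I01 `*` I01) (clamp q.1, clamp q.2) ->
      P (clamp q.1, clamp q.2) by exact: (cc _ _ _ _ hP).
  suff : \forall q \near p, P (clamp q.1, clamp q.2) by [].
  apply: filterS k => q; apply.
  exact: (conj (clamp_itv q.1) (clamp_itv q.2)).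
exact: cvg_comp cw (cH _ Kp).
Qed.

Lemma rotation_loop_homotopic (rho : R) a b : (2 < N)%N -> rho != 0 ->
  loop_homotopic (Conf (g_rho rho)) id (rotation_loop a) (rotation_loop b) ->
  a = b.
Proof.
move=> N2 rho0 [H [cH HC Hst Hper]].
have cH' := continuous_clamp cH.
have [cRe cIm] := frame_det_continuous.
pose K p := H (clamp p.1, clamp p.2).
have c01 (t : R) : I01 (clamp t) by exact: clamp_itv.
have c0 : clamp (0 : R) = 0 by rewrite clamp_id// lexx ler01.
have c1 : clamp (1 : R) = 1 by rewrite clamp_id// lexx ler01.
have loopE m (t : R) : frame_det (rotation_loop m t) =
    (cos (t * ((N * m)%:R * (pi *+ 2))) +i* sin (t * ((N * m)%:R * (pi *+ 2))))%C.
  rewrite frame_det_rotation natrM (_ : _ * (_ * t) = t * (N%:R * m%:R * (pi *+ 2)))//.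
  by ring.
have := @winding_homotopy R (fun p => complex.Re (frame_det (K p)))
  (fun p => complex.Im (frame_det (K p))) (N * a) (N * b).
(* The winding numbers compared are N a and N b, and N = n + 1 is positive. *)
move=> W; apply/eqP; rewrite -(@eqn_pmul2l N)//; apply/eqP; apply: W.
- by move=> p; apply: (@continuous_comp _ _ _ K
    (fun psi => complex.Re (frame_det psi))); [exact: cH'|exact: cRe].
- by move=> p; apply: (@continuous_comp _ _ _ K
    (fun psi => complex.Im (frame_det psi))); [exact: cH'|exact: cIm].
- move=> p; have := frame_det_neq0 N2 rho0 (HC (clamp p.1, clamp p.2) (conj (c01 _) (c01 _))).
  rewrite -/(K p); case: (frame_det (K p)) => x y; rewrite eq_complex /= => xy.
  by rewrite lt_neqAle eq_sym paddr_eq0 ?sqr_ge0// !sqrf_eq0 xy addr_ge0 ?sqr_ge0.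
- move=> s; rewrite /K /= c0 c1; have [-> ->] := Hper _ (c01 s).
  by [].
- move=> t t01; rewrite /K /= c0 (clamp_id t01).
  by have [-> _] := Hst t t01; rewrite loopE.
- move=> t t01; rewrite /K /= c1 (clamp_id t01).
  by have [_ ->] := Hst t t01; rewrite loopE.
Qed.

Lemma rotation_loop_refl (rho : R) m :
  loop_homotopic (Conf (g_rho rho)) id (rotation_loop m) (rotation_loop m).
Proof.
exists (fun p => rotation_loop m p.2); split.
- apply: continuous_subspaceT => p.
  apply: (@continuous_comp _ _ _ snd (rotation_loop m)); first exact: cvg_snd.
  exact: rotation_continuous.
- by move=> p _; exact: rotation_Conf.
- by [].
- by move=> s _; case: (rotation_loopP rho m).
Qed.

End FrameDeterminant.

Theorem theorem3p1 (R : realType) (k : nat) (rho : R) :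
  (1 <= k)%N -> 0 <= rho -> rho != 0 ->
  infinite_set
    (@pi1 R (@sphere_map R (2 * k).+1) (Conf (g_rho rho)) id).
Proof.
move=> k1 _ rho0.
set S := pi1 _ _.
have N2 : (2 < (2 * k).+1)%N by lia.
pose cls (m : nat) : set (R -> @sphere_map R (2 * k).+1) :=
  [set delta | loops (Conf (g_rho rho)) id delta /\
     loop_homotopic (Conf (g_rho rho)) id (rotation_loop m) delta].
(* By reflexivity [rotation_loop b] lies in its own class; if the classes of a and b coincide, it is
   therefore homotopic to [rotation_loop a]. *)
have inj : injective cls.
  move=> a b ab; have : cls b (rotation_loop b).
    by split; [exact: rotation_loopP|exact: rotation_loop_refl].
  by rewrite -ab => -[_]; exact: rotation_loop_homotopic.
have clsS m : S (cls m).
  by exists (rotation_loop m) => //; exact: rotation_loopP.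
move=> finS; apply: infinite_nat.
rewrite (_ : [set: nat] = cls @^-1` S); last first.
  by apply/seteqP; split=> // m _; exact: clsS.
by apply: finite_preimage finS => a b _ _; exact: inj.
Qed.
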